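(* Let $T>0$, let $d\ge 1$ be an integer and let $\mathbb{T}^d=(\mathbb{R}/\mathbb{Z})^d$. Let $(b,v)\in C^1([0,T]\times\mathbb{T}^d;\mathbb{R}^d\times\mathbb{R}^d)$ be a smooth solution of the non-conservative form of the curve-shortening flow $$\partial_\theta b+(v\cdot\nabla)b=(b\cdot\nabla)v+b\,v^2,\qquad v=(b\cdot\nabla)b,$$ with $b^2=1$. Then any dissipative solution $(B,P)$ on $[0,T]$ of the curve-shortening flow (as defined in the context) whose initial value satisfies $B(0)=|B(0)|\,b(0)$ satisfies $B=|B|\,b$ and $P=|B|\,v$ (as $\mathbb{R}^d$-valued measures on $[0,T]\times\mathbb{T}^d$).
   Context: Notation. $C(\mathbb{T}^d,\mathbb{R}^d)'$ is the space of $\mathbb{R}^d$-valued (finite) Borel measures on $\mathbb{T}^d$, the dual of $C(\mathbb{T}^d,\mathbb{R}^d)$; the subscript $w^*$ means that it carries the weak-* topology. Likewise $C([0,T]\times\mathbb{T}^d,\mathbb{R}^d)'$ is the space of $\mathbb{R}^d$-valued Borel measures on $[0,T]\times\mathbb{T}^d$. For a vector-valued measure $B$, $|B|$ denotes its total variation measure (with respect to the Euclidean norm). For vectors, $a\cdot b$ is the Euclidean inner product and $a^2=a\cdot a$; $(a\cdot\nabla)=\sum_j a_j\partial_j$. $\|\cdot\|_\infty$ is the sup over $[0,T]\times\mathbb{T}^d$ of the Euclidean norm. An element $B\in C([0,T],C(\mathbb{T}^d,\mathbb{R}^d)'_{w^*})$ is identified with the measure $B(\theta)\,d\theta$ on $[0,T]\times\mathbb{T}^d$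 when it is considered as a space-time measure, and then $|B|$ is $|B(\theta)|\,d\theta$. Trial functions. Trial functions are triples $(b^*,v^*,A)$ of smooth (here: $C^1$) functions $[0,T]\times\mathbb{T}^d\to\mathbb{R}^d$ with ${b^*}^2=1$ everywhere. For such $(b^*,v^* )$ set $$L_2=-\partial_\theta b^*-(v^*\cdot\nabla)b^*+(b^*\cdot\nabla)v^*+b^*{v^*}^2-b^*\,(b^*\cdot\nabla)(b^*\cdot v^* ),\qquad L_3=-v^*+(b^*\cdot\nabla)b^*.$$ The constants. The following are fixed once and for all. (1) For each initial datum $B_0$, finite constants $K_1,K_2$ depending only on $T$ and $\int_{\mathbb{T}^d}|B_0|$. (2) For each $(b^*,v^* )$, a finite constant $c^*$ depending only on $(b^*,v^* )$, chosen such that at every $(\theta,x)\in[0,T]\times\mathbb{T}^d$ and for all $\beta\in\mathbb{R}^d\setminus\{0\}$, $p\in\mathbb{R}^d$, with $\rho=|\beta|$, $$\sum_{i,j}\frac{(\beta_i-\rho b^*_i)(\beta_j-\rho b^*_j)}{2\rho}(\partial_jv^*_i+\partial_iv^*_j)-\sum_{i,j}\frac{(\beta_i-\rho b^*_i)(p_j-\rho v^*_j)}{\rho}(\partial_jb^*_i-\partial_ib^*_j)+(\rho-\beta\cdot b^* )\big({v^*}^2-b^*\cdot\nabla(b^*\cdot v^* )\big)\le c^*(\rho-\beta\cdot b^* )+\frac{|p-\rho v^*|^2}{2\rho}.$$ Definition (dissipative solution). Let $B_0\in C(\mathbb{T}^d,\mathbb{R}^d)'$. A pair $(B,P)$ with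 $B\in C([0,T],C(\mathbb{T}^d,\mathbb{R}^d)'_{w^*})$ and $P\in C([0,T]\times\mathbb{T}^d,\mathbb{R}^d)'$ is a dissipative solution of the curve-shortening flow with initial data $B_0$ if and only if: (i) $B(0)=B_0$ and $\nabla\cdot B=0$ in the sense of distributions; (ii) $B$ and $P$ are bounded, respectively, in $C^{1/2}([0,T],(C^1(\mathbb{T}^d))'_{w^*})$ and $C([0,T]\times\mathbb{T}^d,\mathbb{R}^d)'$ by $K_1$ and $K_2$; that is, $|\int\varphi\cdot dB(\theta)|\le K_1\|\varphi\|_{C^1}$ and $|\int\varphi\cdot d(B(\theta_1)-B(\theta_0))|\le K_1|\theta_1-\theta_0|^{1/2}\|\varphi\|_{C^1}$ for all $\varphi\in C^1(\mathbb{T}^d,\mathbb{R}^d)$ and $\theta,\theta_0,\theta_1\in[0,T]$, and the total variation of $P$ is at most $K_2$; (iii) for all $\lambda>0$, all $\theta\in[0,T]$, all trial functions $(b^*,v^*,A)$ with $\|A\|_\infty\le\lambda$ and ${b^*}^2=1$, and all $r\ge c^*+\frac{\lambda^2}{2}+\lambda\|v^*\|_\infty$, writing $\eta=|B|-B\cdot b^*$ (a measure on $\mathbb{T}^d$ at each time), $$e^{-r\theta}\int\eta(\theta)+\int_0^\theta e^{-r\sigma}\left[\int P\cdot(A-L_3)+\Big(r-c^*-\frac{A\cdot(A+2v^* )}{2}\Big)\eta-B\cdot\Big(L_2+b^*\frac{A\cdot(A+2v^* )}{2}\Big)\right](\sigma)\,d\sigma\le\int\eta(0).$$ Here all inner integrals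 are over $\mathbb{T}^d$, and the term involving $P$ means the integral of $e^{-r\sigma}(A-L_3)$ against the measure $P$ over $[0,\theta]\times\mathbb{T}^d$ (closed time interval). A dissipative solution without further specification is a dissipative solution with initial data $B_0=B(0)$. *)

(* Defs.v *)
From HB Require Import structures.
From mathcomp Require Import all_boot all_order all_algebra.
From mathcomp Require Import ring.
From mathcomp Require Import all_classical all_reals all_analysis.

Set Implicit Arguments.
Unset Strict Implicit.
Unset Printing Implicit Defensive.

Import Order.TTheory GRing.Theory Num.Theory.
Import numFieldNormedType.Exports.

Local Open Scope classical_set_scope.
Local Open Scope quotient_scope.
Local Open Scope ring_scope.

(* The norm that the library puts on ['rV[R]_n] is the sup norm. *)
Section Euclid.
Context {R : realType} {n : nat}.
Implicit Types u v : 'rV[R]_n.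

Definition dot u v : R := \sum_i u 0 i * v 0 i.
Definition enorm u : R := Num.sqrt (dot u u).

Lemma dot_ge0 u : 0 <= dot u u.
Proof. by apply: sumr_ge0 => i _; rewrite -expr2 sqr_ge0. Qed.

Lemma enorm_ge0 u : 0 <= enorm u. Proof. exact: sqrtr_ge0. Qed.

Lemma dotC u v : dot u v = dot v u.
Proof. by apply: eq_bigr => i _; rewrite mulrC. Qed.

Lemma dot_lin (a b : R) u v w :
  dot (a *: u + b *: v) w = a * dot u w + b * dot v w.
Proof.
rewrite /dot !mulr_sumr -big_split; apply: eq_bigr => i _.
by rewrite !mxE mulrDl !mulrA.
Qed.

Lemma enorm_sqr u : enorm u ^+ 2 = dot u u.
Proof. by rewrite sqr_sqrtr // dot_ge0. Qed.

Lemma enorm_eq0 u : (enorm u == 0) = (u == 0).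
Proof.
apply/eqP/eqP => [u0|->]; last first.
  by rewrite /enorm /dot big1 ?sqrtr0 // => i _; rewrite mxE mul0r.
have : dot u u = 0 by rewrite -enorm_sqr u0 expr0n.
move/eqP; rewrite psumr_eq0 => [|i _]; last by rewrite -expr2 sqr_ge0.
move=> /allP h; apply/rowP => i; rewrite mxE; apply/eqP.
by have := h i (mem_index_enum i); rewrite -expr2 sqrf_eq0.
Qed.

Lemma dot_le u v : dot u v <= enorm u * enorm v.
Proof.
have [->|v0] := eqVneq v 0.
  by rewrite /dot big1 ?mulr_ge0 ?enorm_ge0 // => i _; rewrite mxE mulr0.
have vp : 0 < dot v v by rewrite -enorm_sqr exprn_gt0 // lt0r enorm_eq0 v0 enorm_ge0.
have := dot_ge0 (dot v v *: u + (- dot u v) *: v).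
rewrite dot_lin ![dot _ (_ + _)]dotC !dot_lin (dotC v u).
have -> : dot v v * (dot v v * dot u u + - dot u v * dot u v) +
   - dot u v * (dot v v * dot u v + - dot u v * dot v v) =
   dot v v * (dot u u * dot v v - dot u v ^+ 2) by ring.
rewrite pmulr_rge0 // subr_ge0 -!enorm_sqr -exprMn => h.
apply: le_trans (ler_norm _) _.
by rewrite -(ler_pXn2r (n := 2)) ?nnegrE ?mulr_ge0 ?enorm_ge0 // real_normK // num_real.
Qed.

End Euclid.

Section TotalVariation.
Context {dX : measure_display} {X : measurableType dX} {R : realType} {n : nat}.

Definition vmeasure := 'I_n -> {charge set X -> \bar R}.

Implicit Type nu : vmeasure.

Definition vval nu (E : set X) : 'rV[R]_n := \row_i fine (nu i E).

(* Finite families of disjoint measurable subsets of E instead of finite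
   measurable partitions of E: for measurable E the supremum is the same (add
   the remainder to the family), and for any other E it is still nonnegative. *)
Definition variations nu (E : set X) : set (\bar R) :=
  [set s | exists (m : nat) (F : nat -> set X),
     [/\ forall k, measurable (F k), trivIset setT F, forall k, F k `<=` E &
         s = (\sum_(k < m) enorm (vval nu (F k)))%:E]].

Definition totvar nu (E : set X) : \bar R := ereal_sup (variations nu E).

Lemma variations0 nu E : variations nu E 0%E.
Proof.
exists 0%N, (fun=> set0); split => [//||k|]; last by rewrite big_ord0.
- by move=> i j _ _ [x []].
- exact: sub0set.
Qed.

Lemma totvar_ge0 nu E : (0 <= totvar nu E)%E.
Proof. by apply: ereal_sup_ubound; exact: variations0. Qed.

Lemma totvar_ub nu E s : variations nu E s -> (s <= totvar nu E)%E.
Proof. by move=> h; exact: ereal_sup_ubound. Qed.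

Lemma vval0 nu : vval nu set0 = 0.
Proof. by apply/rowP => i; rewrite !mxE charge0. Qed.

Lemma enorm0 : enorm (0 : 'rV[R]_n) = 0.
Proof. by apply/eqP; rewrite enorm_eq0. Qed.

Lemma totvar0 nu : totvar nu set0 = 0%E.
Proof.
apply/eqP; rewrite eq_le totvar_ge0 andbT; apply: ge_ereal_sup => s [m [F [_ _ F0 ->]]].
rewrite big1 // => k _.
have -> : F k = set0 by rewrite -subset0; exact: F0.
by rewrite vval0 enorm0.
Qed.

Lemma totvar_superadd nu A B : A `&` B = set0 ->
  (totvar nu A + totvar nu B <= totvar nu (A `|` B))%E.
Proof.
move=> AB0; set t := totvar nu (A `|` B).
have key a b : variations nu A a -> variations nu B b -> (a + b <= t)%E.
  move=> [m [F [mF tF FA ->]]] [p [G [mG tG GB ->]]].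
  apply: totvar_ub; exists (m + p)%N, (fun k => if (k < m)%N then F k else G (k - m)%N).
  have FG i j x : F i x -> G j x -> False.
    by move=> /FA Ax /GB Bx; have : (A `&` B) x by []; rewrite AB0.
  split.
  - by move=> k; case: ifP.
  - move=> i j _ _; case: ifPn => im; case: ifPn => jm [x [x1 x2]].
    + by apply: tF => //; exists x.
    + by case: (FG _ _ _ x1 x2).
    + by case: (FG _ _ _ x2 x1).
    + have /(tG _ _ I I) : G (i - m)%N `&` G (j - m)%N !=set0 by exists x.
      by move: im jm; rewrite -!leqNgt => im jm e; rewrite -(subnK im) -(subnK jm) e.
  - by move=> k x; case: ifP => _ => [/FA|/GB]; [left|right].
  - rewrite -EFinD big_split_ord /=; congr (_ + _)%:E; apply: eq_bigr => k _.
      by rewrite ltn_ord.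
    by rewrite ltnNge leq_addr /= addKn.
have [->|tNy] := eqVneq t +oo%E; first by rewrite leey.
have tf : t \is a fin_num by rewrite ge0_fin_numE ?totvar_ge0 // ltey.
have key2 b : variations nu B b -> (totvar nu A + b <= t)%E.
  move=> Bb; have bf : b \is a fin_num by case: Bb => ? [? [_ _ _ ->]].
  rewrite -leeBrDr //; apply: ge_ereal_sup => a Aa.
  by rewrite leeBrDr //; exact: key.
have Af : totvar nu A \is a fin_num.
  rewrite ge0_fin_numE ?totvar_ge0 //; apply: le_lt_trans (_ : t < +oo)%E; last by rewrite ltey.
  have := key2 0%E; rewrite adde0; apply.
  exact: variations0.
rewrite addeC -leeBrDr //; apply: ge_ereal_sup => b Bb.
by rewrite leeBrDr // addeC; exact: key2.
Qed.

Lemma le_totvar nu A B : A `<=` B -> (totvar nu A <= totvar nu B)%E.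
Proof.
move=> AB; apply: ereal_sup_le => s [m [F [mF tF FA ->]]].
by exists m, F; split => // k; exact: subset_trans (FA k) AB.
Qed.

Lemma vval_sigma_le nu (G : set X) (F : nat -> set X) :
  measurable G -> (forall k, measurable (F k)) -> trivIset setT F ->
  G `<=` \bigcup_k F k ->
  ((enorm (vval nu G))%:E <= \sum_(0 <= k <oo) (enorm (vval nu (G `&` F k)))%:E)%E.
Proof.
move=> mG mF tF GF; set S := (X in (_ <= X)%E).
have S0 : (0 <= S)%E by apply: nneseries_ge0 => k _ _; rewrite lee_fin enorm_ge0.
have [->|SNy] := eqVneq S +oo%E; first by rewrite leey.
have Sf : S \is a fin_num by rewrite ge0_fin_numE // ltey.
set u := vval nu G.
have mGF k : measurable (G `&` F k) by exact: measurableI.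
have tGF : trivIset setT (fun k => G `&` F k) by exact: trivIset_setIl.
have GE : \bigcup_k (G `&` F k) = G by rewrite -setI_bigcupr; exact/setIidPl.
have cvi i : (fun N => \sum_(0 <= k < N) fine (nu i (G `&` F k))) @ \oo --> u 0 i.
  rewrite mxE.
  have c : (fun N => \sum_(0 <= k < N) nu i (G `&` F k))%E @ \oo --> (fine (nu i G))%:E.
    rewrite fineK ?fin_num_measure // -[X in _ --> nu i X]GE.
    by apply: charge_semi_sigma_additive => //; rewrite GE.
  apply: cvg_trans (fine_cvg c); apply: near_eq_cvg; near=> N.
  by rewrite /= -sum_fine // => k _; rewrite fin_num_measure.
have cvu : (fun N => \sum_i u 0 i * \sum_(0 <= k < N) fine (nu i (G `&` F k))) @ \oo -->
    dot u u.
  apply: (@cvg_big _ _ +%R 0 xpredT (@add_continuous R) _ _ _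
    (fun i N => u 0 i * \sum_(0 <= k < N) fine (nu i (G `&` F k)))) => i _.
  by apply: cvgMr; exact: cvi.
have h : dot u u <= enorm u * fine S.
  apply: (cvgr_to_le cvu); near=> N.
  have -> : \sum_i u 0 i * \sum_(0 <= k < N) fine (nu i (G `&` F k)) =
      \sum_(0 <= k < N) dot u (vval nu (G `&` F k)).
    rewrite /dot [RHS]exchange_big /=; apply: eq_bigr => i _.
    by rewrite mulr_sumr; apply: eq_bigr => k _; congr (_ * _); rewrite mxE.
  apply: (@le_trans _ _ (\sum_(0 <= k < N) enorm u * enorm (vval nu (G `&` F k)))).
    by apply: ler_sum => k _; exact: dot_le.
  rewrite -mulr_sumr ler_wpM2l ?enorm_ge0 // -lee_fin fineK // -sumEFin.
  by apply: nneseries_lim_ge => k _ _; rewrite lee_fin enorm_ge0.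
rewrite -(fineK Sf) lee_fin.
have [->|u0] := eqVneq (enorm u) 0; first by rewrite fine_ge0.
by move: h; rewrite -enorm_sqr expr2 ler_pM2l // lt0r u0 enorm_ge0.
Unshelve. all: by end_near. Qed.

Lemma totvar_sigma_additive nu : semi_sigma_additive (totvar nu).
Proof.
move=> F mF tF _.
have c : cvgn (fun N => \sum_(0 <= k < N) totvar nu (F k))%E.
  by apply: is_cvg_nneseries => k _ _; exact: totvar_ge0.
suff -> : totvar nu (\bigcup_k F k) = (\sum_(0 <= k <oo) totvar nu (F k))%E by [].
apply/eqP; rewrite eq_le; apply/andP; split.
- apply: ge_ereal_sup => s [m [G [mG tG GF ->]]].
  rewrite -sumEFin.
  apply: (@le_trans _ _ (\sum_(j < m) \sum_(0 <= k <oo) (enorm (vval nu (G j `&` F k)))%:E)%E).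
    by apply: lee_sum => j _; exact: vval_sigma_le.
  rewrite -nneseries_sum; last by move=> j k _; rewrite lee_fin enorm_ge0.
  apply: lee_nneseries => [k _ _|k _].
    by apply: sume_ge0 => j _; rewrite lee_fin enorm_ge0.
  apply: totvar_ub; exists m, (fun j => G j `&` F k); split.
  + by move=> j; exact: measurableI.
  + exact: trivIset_setIr.
  + by move=> j; exact: subIsetr.
  + by rewrite sumEFin.
- apply: lime_le => //; near=> N.
  apply: (@le_trans _ _ (totvar nu (\big[setU/set0]_(k < N) F k))); last first.
    by apply: le_totvar; rewrite -bigcup_mkord; exact: bigcup_subset.
  elim: (N) => [|p IH]; first by rewrite big_geq // big_ord0 totvar0.
  rewrite big_nat_recr //= big_ord_recr /=.
  apply: le_trans (totvar_superadd _ _); first by rewrite leeD2r.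
  have := @trivIset_bigsetUI _ xpredT F.
  rewrite [X in trivIset X](_ : _ = setT); last exact/seteqP.
  exact.
Unshelve. all: by end_near. Qed.

HB.instance Definition _ nu :=
  isMeasure.Build dX X R (totvar nu) (totvar0 nu) (totvar_ge0 nu)
    (@totvar_sigma_additive nu).

End TotalVariation.
Arguments vmeasure {dX} X R n.

Section Integral.
Context {dX : measure_display} {X : measurableType dX} {R : realType}.

Lemma hahn_pair (nu : {charge set X -> \bar R}) :
  {PN : set X * set X | hahn_decomposition nu PN.1 PN.2}.
Proof.
by apply: cid; have [P [N PN]] := Hahn_decomposition nu; exists (P, N).
Qed.

(* The value does not depend on the Hahn decomposition that is picked
   (Hahn_decomposition_uniq). *)
Definition cintegral (nu : {charge set X -> \bar R}) (D : set X) (f : X -> R) : R :=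
  \int[jordan_pos (svalP (hahn_pair nu))]_(x in D) f x -
  \int[jordan_neg (svalP (hahn_pair nu))]_(x in D) f x.

Definition vintegral {n : nat} (nu : vmeasure X R n) (D : set X)
    (phi : X -> 'rV[R]_n) : R :=
  \sum_i cintegral (nu i) D (fun x => phi x 0 i).

(* The R^n-valued measure f mu. *)
Definition fmeasure {n : nat} (mu : {measure set X -> \bar R})
    (f : X -> 'rV[R]_n) (i : 'I_n) (E : set X) : \bar R :=
  (\int[mu]_(x in E) (f x 0 i)%:E)%E.

End Integral.

Section Torus.
Context (R : realType) (d : nat).

Definition lattice_rel (x y : 'rV[R]_d) : bool :=
  [forall i, (x 0 i - y 0 i) \is a Num.int].

Lemma lattice_refl : reflexive lattice_rel.
Proof. by move=> x; apply/forallP => i; rewrite subrr rpred0. Qed.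

Lemma lattice_sym : symmetric lattice_rel.
Proof. by move=> x y; apply: eq_forallb => i; rewrite -rpredN opprB. Qed.

Lemma lattice_trans : transitive lattice_rel.
Proof.
move=> y x z /forallP xy /forallP yz; apply/forallP => i.
by rewrite -(subrK (y 0 i) (x 0 i)) -addrA rpredD.
Qed.

Definition lattice_equiv := EquivRel _ lattice_refl lattice_sym lattice_trans.

Definition torus := {eq_quot lattice_equiv}.

HB.instance Definition _ := PointedTopological.copy torus (quotient_topology torus).
HB.instance Definition _ := Quotient.on torus.
HB.instance Definition _ := Measurable.copy torus (g_sigma_algebraType (@open torus)).

End Torus.

Section Calculus.
Context {R : realType} {d : nat}.
Implicit Types (f : torus R d -> R) (w : torus R d -> 'rV[R]_d) (x : torus R d).

Definition tpi : 'rV[R]_d -> torus R d := \pi_(torus R d).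

(* Functions on the torus are differentiated through their periodic lift to
   R^d; by periodicity the choice of the representative [repr x] is immaterial. *)
Definition has_pd (j : 'I_d) f x : Prop :=
  derivable (f \o tpi) (repr x) (delta_mx 0 j).

Definition pd (j : 'I_d) f x : R := 'D_(delta_mx 0 j) (f \o tpi) (repr x).

Definition component (i : 'I_d) w : torus R d -> R := fun x => w x 0 i.

Fixpoint Ck (k : nat) f : Prop :=
  match k with
  | 0%N => continuous f
  | k'.+1 => [/\ continuous f, forall j x, has_pd j f x & forall j, Ck k' (pd j f)]
  end.

Definition smooth f : Prop := forall k, Ck k f.

Definition C1field w : Prop := forall i, Ck 1 (component i w).

Definition C1norm w : R :=
  sup (range (fun x => enorm (w x))) +
  sup (range (fun x => Num.sqrt (\sum_i \sum_j pd j (component i w) x ^+ 2))).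

Definition grad f x : 'rV[R]_d := \row_j pd j f x.

(* [advs a f x] is (a . nabla) f at x, and [adv a w x] is (a . nabla) w at x. *)
Definition advs (a : 'rV[R]_d) f x : R := \sum_j a 0 j * pd j f x.

Definition adv (a : 'rV[R]_d) w x : 'rV[R]_d := \row_i advs a (component i w) x.

End Calculus.

Section SpaceTime.
Context {R : realType} {d : nat}.

(* Functions on [0, T] x T^d are represented by functions on R x T^d of which
   only the values at times in [0, T] are ever used. *)
Definition stfield := R -> torus R d -> 'rV[R]_d.

Implicit Types (T : R) (g : R -> R) (f : R -> torus R d -> R) (b v A : stfield).

(* Derivative at t relative to [0, T] (one-sided at both ends). *)
Definition tquot g (t s : R) : R := (s - t)^-1 * (g s - g t).

Definition has_dtime T g (t : R) : Prop :=
  cvg (tquot g t s @[s --> within `[0, T] t^']).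

Definition dtime T g (t : R) : R := lim (tquot g t s @[s --> within `[0, T] t^']).

Definition cylinder (t : R) : set (R * torus R d) := `[0, t] `*` setT.

Definition C1st T f : Prop :=
  [/\ {within cylinder T, continuous (fun z => f z.1 z.2)},
      forall t x, t \in `[0, T] -> has_dtime T (f ^~ x) t,
      forall j t x, t \in `[0, T] -> has_pd j (f t) x,
      {within cylinder T, continuous (fun z => dtime T (f ^~ z.2) z.1)} &
      forall j, {within cylinder T, continuous (fun z => pd j (f z.1) z.2)}].

Definition C1fieldst T b : Prop := forall i, C1st T (fun t x => b t x 0 i).

Definition dtimev T b (t : R) (x : torus R d) : 'rV[R]_d :=
  \row_i dtime T (fun s => b s x 0 i) t.

Definition supnorm T b : R :=
  sup [set enorm (b z.1 z.2) | z in cylinder T].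

Definition unit_field T b : Prop :=
  forall t x, t \in `[0, T] -> dot (b t x) (b t x) = 1.

Definition L2 T b v (t : R) (x : torus R d) : 'rV[R]_d :=
  - dtimev T b t x - adv (v t x) (b t) x + adv (b t x) (v t) x
  + dot (v t x) (v t x) *: b t x
  - advs (b t x) (fun y => dot (b t y) (v t y)) x *: b t x.

Definition L3 b v (t : R) (x : torus R d) : 'rV[R]_d :=
  - v t x + adv (b t x) (b t) x.

Definition csf_smooth_solution T b v : Prop :=
  [/\ C1fieldst T b, C1fieldst T v, unit_field T b &
      forall t x, t \in `[0, T] ->
        dtimev T b t x + adv (v t x) (b t) x
          = adv (b t x) (v t) x + dot (v t x) (v t x) *: b t x
        /\ v t x = adv (b t x) (b t) x].

Definition cstar_bound T b v (c : R) : Prop :=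
  forall t x (beta p : 'rV[R]_d), t \in `[0, T] -> beta != 0 ->
    let rho := enorm beta in
    let bs := b t x in
    let vs := v t x in
    let db j i := pd j (component i (b t)) x in
    let dv j i := pd j (component i (v t)) x in
    let e i := beta 0 i - rho * bs 0 i in
    \sum_i \sum_j e i * e j / (2 * rho) * (dv j i + dv i j)
    - \sum_i \sum_j e i * (p 0 j - rho * vs 0 j) / rho * (db j i - db i j)
    + (rho - dot beta bs)
        * (dot vs vs - advs bs (fun y => dot (b t y) (v t y)) x)
    <= c * (rho - dot beta bs)
       + dot (p - rho *: vs) (p - rho *: vs) / (2 * rho).

(* The second clause says that c* only depends on the values of (b, v) on
   [0, T] x T^d. *)
Definition cstar_spec T (cstar : stfield -> stfield -> R) : Prop :=
  (forall b v, C1fieldst T b -> C1fieldst T v -> unit_field T b ->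
     cstar_bound T b v (cstar b v)) /\
  (forall b v b' v',
     (forall t x, t \in `[0, T] -> b t x = b' t x /\ v t x = v' t x) ->
     cstar b v = cstar b' v').

(* Integral of g against eta = |nu| - nu . w. *)
Definition eta_integral (nu : vmeasure (torus R d) R d)
    (w : torus R d -> 'rV[R]_d) (g : torus R d -> R) : R :=
  \int[totvar nu]_x g x - vintegral nu setT (fun x => g x *: w x).

Record dissipative_solution T (K1 K2 : R -> R -> R) (cstar : stfield -> stfield -> R)
    (B0 : vmeasure (torus R d) R d)
    (B : R -> vmeasure (torus R d) R d)
    (P : vmeasure (R * torus R d)%type R d) : Prop := DissipativeSolution {
  ds_weak_continuous : forall phi : torus R d -> 'rV[R]_d, continuous phi ->
    {within `[0, T], continuous (fun t => vintegral (B t) setT phi)} ;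
  (* P is a measure on [0, T] x T^d *)
  ds_carried : forall i E, measurable E -> E `&` cylinder T = set0 -> P i E = 0%E ;
  ds_initial : forall i E, measurable E -> B 0 i E = B0 i E ;
  ds_divfree : forall t psi, t \in `[0, T] -> smooth psi ->
    vintegral (B t) setT (grad psi) = 0 ;
  ds_bounded : forall t phi, t \in `[0, T] -> C1field phi ->
    `|vintegral (B t) setT phi| <= K1 T (fine (totvar B0 setT)) * C1norm phi ;
  ds_holder : forall t0 t1 phi, t0 \in `[0, T] -> t1 \in `[0, T] -> C1field phi ->
    `|vintegral (B t1) setT phi - vintegral (B t0) setT phi|
      <= K1 T (fine (totvar B0 setT)) * Num.sqrt `|t1 - t0| * C1norm phi ;
  ds_momentum_bounded :
    (totvar P setT <= (K2 T (fine (totvar B0 setT)))%:E)%E ;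
  ds_dissipation : forall (lambda t r : R) b v A,
    0 < lambda -> t \in `[0, T] ->
    C1fieldst T b -> C1fieldst T v -> C1fieldst T A -> unit_field T b ->
    supnorm T A <= lambda ->
    cstar b v + lambda ^+ 2 / 2 + lambda * supnorm T v <= r ->
    let h s x := dot (A s x) (A s x + 2 *: v s x) / 2 in
    expR (- (r * t)) * eta_integral (B t) (b t) (cst 1)
    + vintegral P (cylinder t)
        (fun z => expR (- (r * z.1)) *: (A z.1 z.2 - L3 b v z.1 z.2))
    + \int[lebesgue_measure]_(s in `[0, t])
        (expR (- (r * s)) *
          (eta_integral (B s) (b s) (fun x => r - cstar b v - h s x)
           - vintegral (B s) setT (fun x => L2 T b v s x + h s x *: b s x)))
    <= eta_integral (B 0) (b 0) (cst 1)
}.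

(* The measures B(t) dt and f |B(t)| dt on [0, T] x T^d. *)
Definition st_measure T (B : R -> vmeasure (torus R d) R d) (i : 'I_d)
    (E : set (R * torus R d)) : \bar R :=
  (\int[lebesgue_measure]_(t in `[0%R, T]) B t i (xsection E t))%E.

Definition st_fmeasure T (B : R -> vmeasure (torus R d) R d) (f : stfield) (i : 'I_d)
    (E : set (R * torus R d)) : \bar R :=
  (\int[lebesgue_measure]_(t in `[0%R, T])
     fmeasure (totvar (B t)) (f t) i (xsection E t))%E.

End SpaceTime.
Arguments stfield R d : clear implicits.

(* Main.v *)
Require Import Defs.
From mathcomp Require Import all_boot all_order all_algebra.
From mathcomp Require Import ring lra.
From mathcomp Require Import all_classical all_reals all_analysis.
From mathcomp Require Import measurable_realfun.

Set Implicit Arguments.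
Unset Strict Implicit.
Unset Printing Implicit Defensive.

Import Order.TTheory GRing.Theory Num.Theory.
Import numFieldNormedType.Exports.

Local Open Scope classical_set_scope.
Local Open Scope ring_scope.

(** Weak-strong uniqueness by relative energy: the smooth solution [(b, v)] is
    itself used as a trial field for the dissipative solution.

    Since [b . b = 1] and [v = (b . nabla) b], the velocity is orthogonal to [b],
    so the equations of the flow say that [L2 = L3 = 0] for the trial fields
    [b* = b], [v* = v]. With [A = 0] the dissipation inequality then says that
    the total defect, the integral of [|B(t)| - B(t) . b(t)], is bounded by a
    constant times its initial value ([defect_decay]), which is [0]. The defect is
    nonnegative by the duality between a vector measure and its total variation
    ([vintegral_le]), so it vanishes at every time. A unit field that attains the
    total mass in this duality is the polar density ([polar_of_norming]), whence
    [B(t) = |B(t)| b(t)].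

    Now let [A] be [e] times a test function [alpha] in the coordinate direction
    [i]. The defect terms are [0], and what remains of the inequality is
    [e (int alpha dP_i - int alpha v_i d|B| dt) <= (e^2 / 2) int alpha^2 d|B| dt],
    up to exponential weights that are absorbed in [alpha]. Letting [e] tend to
    [0] from both sides gives equality of the two integrals ([momentum_test]).

    To pass from test functions to measures, [|B(t)| dt] has to be measurable
    in time. This follows from the polar form: the integral of [f(t)] against
    [|B(t)|] is the integral of [f(t) b(t)] against [B(t)], which is continuous in
    time because [B] is weak-* continuous and its mass is bounded; the bound on
    the mass comes from the dissipation inequality for the constant trial fields
    [e_1] and [- e_1] ([mass_bounded]). Finally, products of [C^1] functions of
    time and of space approximate the indicators of a pi-system of rectangles
    that generates the Borel sets ([measurable_approx_rect]), and a monotone class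
    argument concludes. *)

(** * Bounded measurable functions *)

Section BoundedMeasurable.
Context {dX : measure_display} {X : measurableType dX} {R : realType}.
Implicit Types (D : set X) (f g : X -> R).

Definition bdmeas D f :=
  measurable_fun D f /\ exists M : R, forall x, D x -> `|f x| <= M.

Lemma bdmeas_cst D c : bdmeas D (fun=> c).
Proof. by split; [exact: measurable_cst|exists `|c|]. Qed.

Lemma bdmeasD D f g : bdmeas D f -> bdmeas D g -> bdmeas D (fun x => f x + g x).
Proof.
move=> [mf [M fM]] [mg [N gN]]; split; first exact: measurable_funD.
by exists (M + N) => x Dx; rewrite (le_trans (ler_normD _ _))// lerD ?fM ?gN.
Qed.

Lemma bdmeasM D f g : bdmeas D f -> bdmeas D g -> bdmeas D (fun x => f x * g x).
Proof.
move=> [mf [M fM]] [mg [N gN]]; split; first exact: measurable_funM.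
by exists (M * N) => x Dx; rewrite normrM ler_pM ?fM ?gN.
Qed.

Lemma bdmeasZ D c f : bdmeas D f -> bdmeas D (fun x => c * f x).
Proof. by move=> h; apply: bdmeasM => //; exact: bdmeas_cst. Qed.

Lemma bdmeasN D f : bdmeas D f -> bdmeas D (fun x => - f x).
Proof.
by move=> h; under eq_fun do rewrite -mulN1r; exact: bdmeasZ.
Qed.

Lemma bdmeasB D f g : bdmeas D f -> bdmeas D g -> bdmeas D (fun x => f x - g x).
Proof. by move=> hf /bdmeasN; exact: bdmeasD. Qed.

Lemma bdmeas_sum D (I : Type) (r : seq I) (P : pred I) (F : I -> X -> R) :
  (forall i, P i -> bdmeas D (F i)) -> bdmeas D (fun x => \sum_(i <- r | P i) F i x).
Proof.
move=> h; elim: r => [|i r IH].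
  by under eq_fun do rewrite big_nil; exact: bdmeas_cst.
under eq_fun do rewrite big_cons.
by case: (boolP (P i)) => // Pi; apply: bdmeasD => //; exact: h.
Qed.

Lemma bdmeas_indic D E : measurable E -> bdmeas D (\1_E : X -> R).
Proof.
move=> mE; split; first exact: measurable_indic.
by exists 1 => x _; rewrite indicE; case: (_ \in _); rewrite ?normr1 ?normr0.
Qed.

Lemma bdmeas_sub D D' f : measurable D' -> D `<=` D' -> bdmeas D' f -> bdmeas D f.
Proof.
move=> mD' DD' [mf [M fM]]; split; first exact: (measurable_funS mD').
by exists M => x /DD'; exact: fM.
Qed.

Lemma bdmeas_integrable (mu : {measure set X -> \bar R}) D f : measurable D ->
  (mu D < +oo)%E -> bdmeas D f -> mu.-integrable D (EFin \o f).
Proof.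
move=> mD muD [mf [M fM]]; apply: measurable_bounded_integrable => //.
by exists M; split; rewrite ?num_real// => y My x Dx; exact: le_trans (fM _ Dx) (ltW My).
Qed.

Lemma bounded_cvg_Rintegral (mu : {measure set X -> \bar R}) D
    (F : nat -> X -> R) f (M : R) : measurable D -> (mu D < +oo)%E ->
  (forall n, measurable_fun D (F n)) ->
  (forall n x, D x -> `|F n x| <= M) ->
  (forall x, D x -> F ^~ x @ \oo --> f x) ->
  \int[mu]_(x in D) F n x @[n --> \oo] --> \int[mu]_(x in D) f x.
Proof.
move=> mD muD mF FM Ff.
have iM : mu.-integrable D (EFin \o (fun=> M)).
  by apply: bdmeas_integrable => //; exact: bdmeas_cst.
have mf : measurable_fun D f by exact: (measurable_fun_cvg _ Ff).
have fM x : D x -> `|f x| <= M.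
  move=> Dx; apply: (cvgr_to_le (cvg_norm (Ff _ Dx))).
  by near=> n; apply: FM.
have If : mu.-integrable D (EFin \o f).
  by apply: bdmeas_integrable => //; split => //; exists M.
apply: fine_cvg; rewrite fineK; last exact: integrable_fin_num.
apply: (@dominated_cvg _ _ _ mu D mD _ _ (EFin \o (fun=> M))) => //.
- by move=> n; exact/measurable_EFinP.
- by move=> x Dx; apply: cvg_EFin; [exact: nearW|exact: Ff].
Unshelve. all: by end_near. Qed.


(** The label is the cell, in a grid of mesh [N.+1%:R^-1], that contains the
    values of the family; boundedness leaves finitely many cells. *)
Lemma quantize (n : nat) (w : 'I_n -> X -> R) (M : R) N :
  (forall i, measurable_fun setT (w i)) -> (forall i x, `|w i x| <= M) ->
  exists (I : finType) (c : X -> I) (a : I -> 'rV[R]_n),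
    (forall k, measurable (c @^-1` [set k])) /\
    (forall i x, `|w i x - a (c x) 0 i| <= N.+1%:R^-1).
Proof.
move=> mw wM; pose h i x := N.+1%:R * (w i x + M).
have N0 : 0 < N.+1%:R :> R by rewrite ltr0n.
have h0 i x : 0 <= h i x.
  by rewrite /h mulr_ge0// -lerBlDr sub0r; have := wM i x; rewrite ler_norml => /andP[].
have hK i x : (Num.truncn (h i x) < (Num.truncn (N.+1%:R * (M + M))).+1)%N.
  rewrite ltnS; apply: le_truncn; rewrite ler_pM2l// lerD2r.
  exact: le_trans (ler_norm _) (wM i x).
pose K := Num.truncn (N.+1%:R * (M + M)).
pose c x : {ffun 'I_n -> 'I_K.+1} := [ffun i => inord (Num.truncn (h i x))].
exists {ffun 'I_n -> 'I_K.+1}, c, (fun k : {ffun 'I_n -> 'I_K.+1} => \row_i ((k i : nat)%:R / N.+1%:R - M)); split => [k|i x].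
  have -> : c @^-1` [set k] =
      \bigcap_(i in [set: 'I_n]) [set x | (k i)%:R <= h i x < (k i).+1%:R].
    apply/seteqP; split => x /=.
      move=> ck; move=> i _ /=.
      by rewrite -truncn_eq// -ck ffunE inordK.
    move=> ck; apply/ffunP => i; rewrite ffunE; apply/val_inj.
    by rewrite /= inordK//; apply/eqP; rewrite truncn_eq//; apply: ck.
  apply: fin_bigcap_measurable => // i _.
  have mh : measurable_fun setT (h i).
    by apply: measurable_funM => //; apply: measurable_funD.
  rewrite [X in measurable X](_ : _ = setT `&` (h i @^-1` `[(k i)%:R, (k i).+1%:R[%classic)).
    by apply: mh => //; exact: measurable_itv.
  by rewrite setTI; apply/seteqP; split => x /=; rewrite in_itv.
rewrite mxE ffunE inordK// opprB addrA.
have /andP[t1 t2] := truncn_itv (h0 i x).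
rewrite -[w i x + M](mulKf (lt0r_neq0 N0)) -/(h i x) mulrC -mulrBl.
rewrite normrM [`|_^-1|]ger0_norm ?invr_ge0 ?ler0n// ler_piMl ?invr_ge0 ?ler0n//.
rewrite ger0_norm ?subr_ge0// lerBlDr.
by apply: ltW; apply: lt_le_trans t2 _; rewrite -natr1 addrC.
Qed.

Lemma sum_fibers (I : finType) (c : X -> I) (a : I -> R) x :
  a (c x) = \sum_k a k * \1_(c @^-1` [set k]) x.
Proof.
rewrite (bigD1 (c x))//= big1 ?addr0 => [|k /eqP kc].
  by rewrite indicE mem_set ?mulr1.
by rewrite indicE memNset ?mulr0// => /= ck; apply: kc.
Qed.

(** Rounding exhibits a bounded measurable function as a bounded limit of
    linear combinations of indicators. *)
Lemma bdmeas_ind (P : (X -> R) -> Prop) :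
  (forall E, measurable E -> P (\1_E)) ->
  (forall f g, bdmeas setT f -> bdmeas setT g -> P f -> P g -> P (fun x => f x + g x)) ->
  (forall c f, bdmeas setT f -> P f -> P (fun x => c * f x)) ->
  (forall (F : nat -> X -> R) f (M : R), (forall n, bdmeas setT (F n)) -> (forall n, P (F n)) ->
     (forall n x, `|F n x| <= M) -> (forall x, F ^~ x @ \oo --> f x) -> P f) ->
  forall f, bdmeas setT f -> P f.
Proof.
move=> P1 PD PZ Plim f [mf [M fM]].
have P0 c : P (fun=> c).
  have -> : (fun=> c) = (fun x : X => c * \1_setT x).
    by apply/funext => x; rewrite indicT mulr1.
  apply: PZ; [exact: bdmeas_indic|exact: P1].
have /choice[F FP] : forall N : nat, exists F : X -> R,
    [/\ bdmeas setT F, P F & forall x, `|f x - F x| <= N.+1%:R^-1].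
  move=> N; have [//|i x|I [c [a [mc ca]]]] := @quantize 1 (fun=> f) M N.
    exact: fM.
  exists (fun x => a (c x) 0 0); split; last by move=> x; exact: ca.
    under eq_fun do rewrite (sum_fibers c (fun k => a k 0 0)).
    by apply: bdmeas_sum => k _; apply: bdmeasZ; exact: bdmeas_indic.
  under eq_fun do rewrite (sum_fibers c (fun k => a k 0 0)).
  elim: (index_enum _) => [|k s IH].
    by under eq_fun do rewrite big_nil.
  under eq_fun do rewrite big_cons.
  apply: PD => //; first exact/bdmeasZ/bdmeas_indic.
    by apply: bdmeas_sum => i _; exact/bdmeasZ/bdmeas_indic.
  by apply: PZ; [exact: bdmeas_indic|exact: P1].
apply: (Plim F f (M + 1)) => [n|n|n x|x]; try by case: (FP n).
- have [_ _ /(_ x)] := FP n; rewrite distrC => h.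
  rewrite -[F n x](subrK (f x)) addrC (le_trans (ler_normD _ _))// lerD//; first exact: fM.
  by apply: (le_trans h); rewrite invf_le1// ?ler1n// ltr0n.
- apply/cvgrPdist_le => e e0; near=> n; have [_ _ /(_ x)] := FP n; move/le_trans; apply.
  by apply/ltW; near: n; exact: (near_infty_natSinv_lt (PosNum e0)).
Unshelve. all: by end_near. Qed.

End BoundedMeasurable.

(** * Integration against charges *)

Section ChargeIntegral.
Context {dX : measure_display} {X : measurableType dX} {R : realType}.
Implicit Types (D E : set X) (f g : X -> R) (nu : {charge set X -> \bar R}).

Local Notation jp nu := (jordan_pos (svalP (hahn_pair nu))).
Local Notation jn nu := (jordan_neg (svalP (hahn_pair nu))).

Lemma Rintegral_indic (mu : {measure set X -> \bar R}) D E :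
  measurable D -> measurable E -> \int[mu]_(x in D) \1_E x = fine (mu (E `&` D)).
Proof. by move=> mD mE; rewrite /Rintegral integral_indic. Qed.

Lemma Rintegral_fibers (mu : {measure set X -> \bar R}) (I : finType) (c : X -> I)
    (h : I -> R) : (mu setT < +oo)%E -> (forall k, measurable (c @^-1` [set k])) ->
  \int[mu]_x h (c x) = \sum_k h k * fine (mu (c @^-1` [set k])).
Proof.
move=> muT mc; under eq_Rintegral do rewrite sum_fibers.
elim: (index_enum _) => [|k s IH].
  by under eq_Rintegral do rewrite big_nil; rewrite Rintegral_cst// mul0r big_nil.
under eq_Rintegral do rewrite big_cons.
rewrite RintegralD//.
- by rewrite RintegralZl ?Rintegral_indic ?setIT ?IH ?big_cons//; apply: bdmeas_integrable => //; exact: bdmeas_indic.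
- by apply: bdmeas_integrable => //; exact/bdmeasZ/bdmeas_indic.
- by apply: bdmeas_integrable => //; apply: bdmeas_sum => i _; exact/bdmeasZ/bdmeas_indic.
Qed.

Lemma fin_charge_lty (mu : {finite_measure set X -> \bar R}) D : measurable D -> (mu D < +oo)%E.
Proof. by move=> mD; rewrite ltey_eq fin_num_measure. Qed.

Lemma eq_cintegral nu D f g : {in D, f =1 g} -> cintegral nu D f = cintegral nu D g.
Proof. by move=> fg; rewrite /cintegral; congr (_ - _); exact: eq_Rintegral. Qed.

Lemma cintegralD nu D f g : measurable D -> bdmeas D f -> bdmeas D g ->
  cintegral nu D (fun x => f x + g x) = cintegral nu D f + cintegral nu D g.
Proof.
move=> mD hf hg; rewrite /cintegral !RintegralD//; first by ring.
all: by apply: bdmeas_integrable => //; exact: fin_charge_lty.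
Qed.

Lemma cintegralZ nu D c f : measurable D -> bdmeas D f ->
  cintegral nu D (fun x => c * f x) = c * cintegral nu D f.
Proof.
move=> mD hf; rewrite /cintegral !RintegralZl//; first by ring.
all: by apply: bdmeas_integrable => //; exact: fin_charge_lty.
Qed.

Lemma cintegral0 nu D : measurable D -> cintegral nu D (fun=> 0) = 0.
Proof. by move=> mD; rewrite /cintegral !Rintegral_cst// !mul0r subrr. Qed.

Lemma fine_jordan nu E : measurable E -> fine (jp nu E) - fine (jn nu E) = fine (nu E).
Proof.
move=> mE; rewrite (jordan_decomp (svalP (hahn_pair nu)) mE) /cadd/= cscaleN1.
by rewrite -fineB ?fin_num_measure.
Qed.

Lemma cintegral_indic nu D E : measurable D -> measurable E ->
  cintegral nu D \1_E = fine (nu (E `&` D)).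
Proof.
by move=> mD mE; rewrite /cintegral !Rintegral_indic// fine_jordan//; exact: measurableI.
Qed.

Lemma cintegral_cvg nu D (F : nat -> X -> R) f (M : R) : measurable D ->
  (forall n, measurable_fun D (F n)) -> (forall n x, D x -> `|F n x| <= M) ->
  (forall x, D x -> F ^~ x @ \oo --> f x) ->
  cintegral nu D (F n) @[n --> \oo] --> cintegral nu D f.
Proof.
move=> mD mF FM Ff; apply: cvgB; apply: (@bounded_cvg_Rintegral _ _ _ _ _ _ _ M) => //;
  exact: fin_charge_lty.
Qed.

Lemma cintegral_fibers nu (I : finType) (c : X -> I) (h : I -> R) :
  (forall k, measurable (c @^-1` [set k])) ->
  cintegral nu setT (fun x => h (c x)) = \sum_k h k * fine (nu (c @^-1` [set k])).
Proof.
move=> mc; rewrite /cintegral !Rintegral_fibers//; try exact: fin_charge_lty.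
by rewrite -sumrB; apply: eq_bigr => k _; rewrite -mulrBr fine_jordan.
Qed.

End ChargeIntegral.

(** * Total variation and polar decomposition *)

Section VectorMeasure.
Context {dX : measure_display} {X : measurableType dX} {R : realType} {n : nat}.
Implicit Types (nu : vmeasure X R n) (w : X -> 'rV[R]_n) (E : set X).

Lemma enorm_le_sum (u : 'rV[R]_n) : enorm u <= \sum_i `|u 0 i|.
Proof.
rewrite -(ler_pXn2r (n := 2)) ?nnegrE ?enorm_ge0 ?sumr_ge0// enorm_sqr expr2 mulr_suml.
apply: ler_sum => i _; rewrite -[u 0 i * _]expr2 -real_normK ?num_real// expr2.
apply: ler_wpM2l => //; rewrite (bigD1 i)//= lerDl; exact: sumr_ge0.
Qed.

Lemma coord_le_enorm (u : 'rV[R]_n) i : `|u 0 i| <= enorm u.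
Proof.
rewrite -(ler_pXn2r (n := 2)) ?nnegrE ?enorm_ge0// real_normK ?num_real// enorm_sqr /dot.
by rewrite (bigD1 i)//= -expr2 lerDl; apply: sumr_ge0 => j _; rewrite -expr2 sqr_ge0.
Qed.

Lemma dot_delta (a : R) i (u : 'rV[R]_n) : dot (a *: delta_mx 0 i) u = a * u 0 i.
Proof.
rewrite /dot (bigD1 i)//= big1 ?addr0 => [|j ji]; rewrite !mxE ?eqxx ?mulr1//.
by rewrite (negbTE ji) andbF mulr0 mul0r.
Qed.

Lemma totvar_lty nu E : (totvar nu E < +oo)%E.
Proof.
pose cv i : {measure set X -> \bar R} := charge_variation (svalP (hahn_pair (nu i))).
apply: (@le_lt_trans _ _ (\sum_i cv i setT)%E); last first.
  apply: lte_sum_pinfty => i _.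
  by rewrite ltey_eq /cv/= /charge_variation fin_numD !fin_num_measure.
apply: ge_ereal_sup => s [m [F [mF tF _ ->]]].
apply: (@le_trans _ _ (\sum_(k < m) \sum_i cv i (F k))%E).
  rewrite -sumEFin; apply: lee_sum => k _.
  apply: (@le_trans _ _ (\sum_i `|vval nu (F k) 0 i|)%:E).
    by rewrite lee_fin enorm_le_sum.
  rewrite -sumEFin; apply: lee_sum => i _; rewrite mxE.
  rewrite -[X in (X <= _)%E]/(`| (fine (nu i (F k)))%:E |)%E fineK ?fin_num_measure//.
  exact: abse_charge_variation.
rewrite exchange_big; apply: lee_sum => i _ /=.
rewrite -measure_semi_additive_ord_I//; last 2 first.
  exact: sub_trivIset tF.
  exact: bigsetU_measurable.
by apply: le_measure; rewrite ?inE//; exact: bigsetU_measurable.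
Qed.

Lemma totvar_fin nu : fin_num_fun (totvar nu).
Proof. by move=> E mE; rewrite ge0_fin_numE ?totvar_ge0// totvar_lty. Qed.

Lemma enorm_vval_le nu E : measurable E -> enorm (vval nu E) <= fine (totvar nu E).
Proof.
move=> mE; rewrite -lee_fin fineK ?totvar_fin//; apply: totvar_ub.
exists 1%N, (fun k => if k == 0%N then E else set0); split.
- by move=> k; case: ifP.
- by move=> i j _ _ [x []]; case: eqP => [->|//]; case: eqP => [->|//].
- by move=> k; case: ifP => _ //; exact: sub0set.
- by rewrite big_ord1.
Qed.

Definition bdfield w := forall i, bdmeas setT (fun x => w x 0 i).

Lemma vintegralD nu w1 w2 : bdfield w1 -> bdfield w2 ->
  vintegral nu setT (fun x => w1 x + w2 x) = vintegral nu setT w1 + vintegral nu setT w2.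
Proof.
move=> h1 h2; rewrite /vintegral -big_split; apply: eq_bigr => i _ /=.
by rewrite -cintegralD//; apply: eq_cintegral => x _; rewrite mxE.
Qed.

Lemma vintegralZ nu c w : bdfield w ->
  vintegral nu setT (fun x => c *: w x) = c * vintegral nu setT w.
Proof.
move=> h; rewrite /vintegral mulr_sumr; apply: eq_bigr => i _ /=.
by rewrite -cintegralZ//; apply: eq_cintegral => x _; rewrite mxE.
Qed.

Lemma eq_vintegral nu D w1 w2 : {in D, w1 =1 w2} -> vintegral nu D w1 = vintegral nu D w2.
Proof. by move=> ww; apply: eq_bigr => i _; apply: eq_cintegral => x /ww ->. Qed.

Lemma vintegral_delta nu D (f : X -> R) i : measurable D ->
  vintegral nu D (fun x => f x *: delta_mx 0 i) = cintegral (nu i) D f.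
Proof.
move=> mD; rewrite /vintegral (bigD1 i)//= big1 ?addr0 => [|j ji].
  by apply: eq_cintegral => x _; rewrite !mxE !eqxx mulr1.
rewrite -[RHS](cintegral0 (nu j) mD); apply: eq_cintegral => x _.
by rewrite !mxE (negbTE ji) andbF mulr0.
Qed.

Lemma bdmeas_enorm w : bdfield w -> bdmeas setT (fun x => enorm (w x)).
Proof.
move=> hw; have hd : bdmeas setT (fun x => dot (w x) (w x)).
  by apply: bdmeas_sum => i _; exact: bdmeasM.
split.
  rewrite /enorm; apply: (@measurableT_comp _ _ _ _ _ _ (@Num.sqrt R)); last exact: hd.1.
  by apply: continuous_measurable_fun; exact: sqrt_continuous.
have /choice[M wM] : forall i, exists M : R, forall x, `|w x 0 i| <= M.
  by move=> i; have [_ [M h]] := hw i; exists M => x; exact: h.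
exists (\sum_i M i) => x _; rewrite ger0_norm ?enorm_ge0//.
by apply: le_trans (enorm_le_sum _) _; apply: ler_sum.
Qed.

(** On fields with finitely many values this is the definition of the total
    variation together with the Cauchy-Schwarz inequality; rounding and bounded
    convergence give the general case. *)
Lemma vintegral_le_enorm nu w : bdfield w ->
  vintegral nu setT w <= \int[totvar nu]_x enorm (w x).
Proof.
move=> hw.
have /choice[M wM] : forall i, exists M : R, forall x, `|w x 0 i| <= M.
  by move=> i; have [_ [M h]] := hw i; exists M => x; exact: h.
pose K : R := \sum_i `|M i|.
have wK i x : `|w x 0 i| <= K.
  apply: le_trans (wM i x) _; apply: le_trans (ler_norm _) _.
  by rewrite /K (bigD1 i)//= lerDl sumr_ge0.
have /choice[F FP] : forall N : nat, exists F : X -> 'rV[R]_n,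
    [/\ bdfield F, vintegral nu setT F <= \int[totvar nu]_x enorm (F x) &
        forall i x, `|w x 0 i - F x 0 i| <= N.+1%:R^-1].
  move=> N; have [i|I [c [a [mc ca]]]] := @quantize _ _ _ _ (fun i x => w x 0 i) K N _ wK.
    exact: (hw i).1.
  exists (a \o c); split => //.
    move=> i; under eq_fun do rewrite /= (sum_fibers c (fun k => a k 0 i)).
    by apply: bdmeas_sum => k _; apply: bdmeasZ; exact: bdmeas_indic.
  rewrite /= (Rintegral_fibers (fun k => enorm (a k)) (totvar_lty _ _) mc).
  rewrite /vintegral.
  under eq_bigr do rewrite /= (cintegral_fibers _ (fun k => a k 0 _) mc).
  rewrite exchange_big /=; apply: ler_sum => k _.
  apply: (@le_trans _ _ (dot (a k) (vval nu (c @^-1` [set k])))).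
    by apply: ler_sum => i _; rewrite mxE.
  apply: le_trans (dot_le _ _) _; apply: ler_wpM2l; first exact: enorm_ge0.
  exact: enorm_vval_le.
have Fw i x : F ^~ x ^~ 0 ^~ i @ \oo --> w x 0 i.
  apply/cvgrPdist_le => e e0; near=> N; have [_ _ /(_ i x)] := FP N; move/le_trans; apply.
  by apply/ltW; near: N; exact: (near_infty_natSinv_lt (PosNum e0)).
have FK N i x : `|F N x 0 i| <= K + 1.
  have [_ _ /(_ i x)] := FP N; rewrite distrC => h.
  rewrite -[F N x 0 i](subrK (w x 0 i)) addrC (le_trans (ler_normD _ _))// lerD//.
  by apply: (le_trans h); rewrite invf_le1// ?ler1n// ltr0n.
have c1 : vintegral nu setT (F N) @[N --> \oo] --> vintegral nu setT w.
  apply: (@cvg_big _ _ +%R 0 xpredT (@add_continuous R) _ _ _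
    (fun i N => cintegral (nu i) setT (fun x => F N x 0 i))) => i _.
  apply: (@cintegral_cvg _ _ _ _ _ _ _ (K + 1)) => // N.
  by have [/(_ i)[]] := FP N.
have c2 : \int[totvar nu]_x enorm (F N x) @[N --> \oo] --> \int[totvar nu]_x enorm (w x).
  apply: (@bounded_cvg_Rintegral _ _ _ _ _ _ _ (n%:R * (K + 1))) => //.
  - exact: totvar_lty.
  - by move=> N; have [/bdmeas_enorm[]] := FP N.
  - move=> N x _; rewrite ger0_norm ?enorm_ge0//; apply: le_trans (enorm_le_sum _) _.
    by apply: le_trans (ler_sum _ (fun i _ => FK N i x)) _; rewrite sumr_const card_ord mulr_natl.
  - move=> x _; have hdot : dot (F N x) (F N x) @[N --> \oo] --> dot (w x) (w x).
      apply: (@cvg_big _ _ +%R 0 xpredT (@add_continuous R) _ _ _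
        (fun i N => F N x 0 i * F N x 0 i)) => i _.
      by apply: cvgM; exact: Fw.
    by apply: (cvg_comp _ _ hdot); exact: sqrt_continuous.
apply: (ler_cvg_to c1 c2); apply: nearW => N; by have [] := FP N.
Unshelve. all: by end_near. Qed.

Lemma vintegral_le nu w (g : X -> R) : bdfield w -> bdmeas setT g ->
  (forall x, enorm (w x) <= g x) -> vintegral nu setT w <= \int[totvar nu]_x g x.
Proof.
move=> hw hg wg; apply: le_trans (vintegral_le_enorm _ hw) _; apply: le_Rintegral => //.
  by apply: bdmeas_integrable => //; [exact: totvar_lty|exact: bdmeas_enorm].
by apply: bdmeas_integrable => //; exact: totvar_lty.
Qed.

Lemma cintegral_le_totvar nu i (f : X -> R) (e : R) : bdmeas setT f ->
  (forall x, `|f x| <= e) -> `|cintegral (nu i) setT f| <= e * fine (totvar nu setT).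
Proof.
have key (g : X -> R) : bdmeas setT g -> (forall x, `|g x| <= e) ->
    cintegral (nu i) setT g <= e * fine (totvar nu setT).
  move=> hg ge; rewrite -Rintegral_cst// -vintegral_delta//; apply: vintegral_le.
  - move=> j; under eq_fun do rewrite !mxE mulrC; exact: bdmeasZ.
  - exact: bdmeas_cst.
  - move=> x; apply: le_trans (enorm_le_sum _) _.
    rewrite (bigD1 i)//= big1 ?addr0 => [|j ji]; rewrite !mxE ?eqxx ?mulr1//.
    by rewrite (negbTE ji) andbF mulr0 normr0.
move=> hf fe; rewrite ler_norml key// andbT lerNl -mulN1r -cintegralZ//.
by apply: key => [|x]; [exact: bdmeasZ|rewrite mulN1r normrN].
Qed.

Definition polar nu (b : X -> 'rV[R]_n) := forall i E, measurable E ->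
  nu i E = fmeasure (totvar nu) b i E.

Lemma polar_fine nu b i E : bdfield b -> measurable E -> polar nu b ->
  fine (nu i E) = \int[totvar nu]_(x in E) b x 0 i.
Proof. by move=> hb mE ->. Qed.

(** Both sides are linear in [f], continuous under bounded convergence, and
    agree on indicators. *)
Lemma polar_cintegral nu b i f : bdfield b -> polar nu b -> bdmeas setT f ->
  cintegral (nu i) setT f = \int[totvar nu]_x (f x * b x 0 i).
Proof.
move=> hb pb; have tT := totvar_lty nu setT; apply: (bdmeas_ind (P := fun f => _ = _)).
- move=> E mE; rewrite cintegral_indic// setIT (polar_fine _ hb)// Rintegral_mkcond.
  by apply: eq_Rintegral => x _; rewrite patchE indicE; case: ifP; rewrite ?mul1r ?mul0r.
- move=> g h hg hh gE hE; rewrite cintegralD// gE hE -RintegralD//.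
  + by apply: eq_Rintegral => x _; rewrite mulrDl.
  + by apply: bdmeas_integrable => //; exact: bdmeasM.
  + by apply: bdmeas_integrable => //; exact: bdmeasM.
- move=> c g hg gE; rewrite cintegralZ// gE -RintegralZl//.
  + by apply: eq_Rintegral => x _; rewrite mulrA.
  + by apply: bdmeas_integrable => //; exact: bdmeasM.
- move=> F g M hF FE FM Fg; have [mb [N bN]] := hb i.
  have c1 := @cintegral_cvg _ _ _ (nu i) setT F g M measurableT (fun n => (hF n).1)
    (fun n x _ => FM n x) (fun x _ => Fg x).
  move: c1; rewrite (_ : (fun k => cintegral (nu i) setT (F k)) =
    (fun k => \int[totvar nu]_x (F k x * b x 0 i))); last exact/funext.
  move=> c1; apply: (cvg_unique _ c1) => //; rewrite /=.
  apply: (@bounded_cvg_Rintegral _ _ _ _ _ _ _ (M * N)) => //.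
  + by move=> k; apply: measurable_funM => //; exact: (hF k).1.
  + by move=> k x _; rewrite normrM ler_pM// bN.
  + by move=> x _; apply: cvgMr_tmp.
Qed.

Lemma polar_vintegral nu b w : bdfield b -> bdfield w -> polar nu b ->
  vintegral nu setT w = \int[totvar nu]_x dot (w x) (b x).
Proof.
move=> hb hw pb; rewrite /vintegral.
under eq_bigr do rewrite (polar_cintegral _ hb pb (hw _)).
rewrite /dot; elim: (index_enum _) => [|i s IH].
  by rewrite big_nil; under eq_Rintegral do rewrite big_nil; rewrite Rintegral_cst// mul0r.
rewrite big_cons IH -RintegralD//.
- by apply: eq_Rintegral => x _; rewrite big_cons.
- by apply: bdmeas_integrable => //; [exact: totvar_lty|exact: bdmeasM].
- apply: bdmeas_integrable => //; first exact: totvar_lty.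
  by apply: bdmeas_sum => j _; exact: bdmeasM.
Qed.

(** Perturbing [b] to [b + e 1_E e_i] increases its norm by at most
    [e b_i 1_E + e^2 / 2], so maximality of the pairing with [b] bounds [e nu_i(E)]
    by [e] times the integral of [b_i] over [E], up to an error of order [e^2].
    Letting [e] tend to [0] from both sides identifies [nu_i(E)]. *)
Lemma polar_of_norming nu b : bdfield b -> (forall x, dot (b x) (b x) = 1) ->
  fine (totvar nu setT) <= vintegral nu setT b -> polar nu b.
Proof.
move=> hb b1 nb i E mE; have tT := totvar_lty nu setT.
have h1 : bdmeas setT (\1_E : X -> R) by exact: bdmeas_indic.
have iE : (totvar nu).-integrable E (EFin \o (fun x => b x 0 i)).
  apply: bdmeas_integrable => //; first exact: totvar_lty.
  exact: bdmeas_sub (hb i).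
suff h : fine (nu i E) = \int[totvar nu]_(x in E) b x 0 i.
  rewrite -[LHS]fineK ?fin_num_measure// h /fmeasure /Rintegral fineK//.
  exact: integrable_fin_num.
set y := fine (nu i E); set z := \int[totvar nu]_(x in E) b x 0 i.
have zE : z = \int[totvar nu]_x (\1_E x * b x 0 i).
  rewrite /z Rintegral_mkcond; apply: eq_Rintegral => x _.
  by rewrite patchE indicE; case: ifP; rewrite ?mul1r ?mul0r.
pose m := fine (totvar nu setT).
have m0 : 0 <= m by rewrite fine_ge0 ?totvar_ge0.
have key e : e * y <= e * z + e ^+ 2 / 2 * m.
  pose g x := 1 + (e * (\1_E x * b x 0 i) + e ^+ 2 / 2).
  have hd : bdfield (fun x => \1_E x *: delta_mx 0 i : 'rV[R]_n).
    by move=> j; under eq_fun do rewrite !mxE mulrC; exact: bdmeasZ.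
  have hed : bdfield (fun x => e *: (\1_E x *: delta_mx 0 i : 'rV[R]_n)).
    by move=> j; under eq_fun do rewrite mxE; apply: bdmeasZ; exact: hd.
  have hEb : bdmeas setT (fun x => \1_E x * b x 0 i) by exact: bdmeasM.
  have hg0 : bdmeas setT (fun x => e * (\1_E x * b x 0 i) + e ^+ 2 / 2).
    by apply: bdmeasD; [exact: bdmeasZ|exact: bdmeas_cst].
  have hg : bdmeas setT g by apply: bdmeasD => //; exact: bdmeas_cst.
  have -> : e * z + e ^+ 2 / 2 * m = \int[totvar nu]_x g x - m.
    rewrite /g RintegralD//; first last.
      by apply: bdmeas_integrable.
      by apply: bdmeas_integrable => //; exact: bdmeas_cst.
    rewrite RintegralD//; first last.
      by apply: bdmeas_integrable => //; exact: bdmeas_cst.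
      by apply: bdmeas_integrable => //; exact: bdmeasZ.
    rewrite RintegralZl//; last exact: bdmeas_integrable.
    by rewrite !Rintegral_cst// -zE -/m; ring.
  have -> : e * y = vintegral nu setT (fun x => b x + e *: (\1_E x *: delta_mx 0 i))
      - vintegral nu setT b.
    rewrite vintegralD// vintegralZ// vintegral_delta// cintegral_indic// setIT -/y.
    by ring.
  rewrite lerB//; apply: vintegral_le => //.
    by move=> j; under eq_fun do rewrite mxE; apply: bdmeasD; [exact: hb|exact: hed].
  (* With t = e 1_E the square of the norm is 1 + 2 t b_i + t^2, and t^2 <= e^2. *)
  move=> x; pose t := e * \1_E x.
  have tE : t ^+ 2 <= e ^+ 2.
    by rewrite /t indicE; case: (_ \in _); rewrite ?mulr1// mulr0 expr0n sqr_ge0.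
  have bi : `|b x 0 i| <= 1.
    apply: le_trans (coord_le_enorm _ _) _; rewrite /enorm b1 sqrtr1 //.
  have nE : dot (b x + e *: (\1_E x *: delta_mx 0 i)) (b x + e *: (\1_E x *: delta_mx 0 i))
      = 1 + 2 * t * b x 0 i + t ^+ 2.
    have dd (u : 'rV[R]_n) : dot (delta_mx 0 i) u = u 0 i.
      by rewrite -[delta_mx 0 i]scale1r dot_delta mul1r.
    have eii : (delta_mx 0 i : 'rV[R]_n) 0 i = 1 by rewrite mxE !eqxx.
    rewrite scalerA -/t -[b x in LHS]scale1r !(dot_lin, dotC _ (_ + _)) b1 ?dd (dotC (b x)) ?dd.
    by rewrite eii; ring.
  pose q := t * b x 0 i.
  have qE : q ^+ 2 <= e ^+ 2.
    apply: le_trans tE; rewrite /q exprMn ler_piMr ?sqr_ge0//.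
    by rewrite -[_ ^+ 2]real_normK ?num_real// expr_le1.
  have gE : g x = 1 + (q + e ^+ 2 / 2) by rewrite /g mulrA.
  have g0 : 0 <= g x by rewrite gE; have := sqr_ge0 (1 + q); nra.
  rewrite -(ler_pXn2r (n := 2)) ?nnegrE ?enorm_ge0// enorm_sqr nE gE -mulrA -/q.
  by have := sqr_ge0 (q + e ^+ 2 / 2); nra.
have zy e : 0 < e -> `|y - z| <= e / 2 * m.
  move=> e0; have k1 := key e; have k2 := key (- e).
  by rewrite ler_norml; apply/andP; split; rewrite -(ler_pM2l e0); nra.
apply/eqP; rewrite -subr_eq0 -normr_le0; apply/ler_addgt0Pr => e e0; rewrite add0r.
have m1 : 0 < m + 1 by rewrite ltr_pwDr.
apply: le_trans (zy (e / (m + 1)) (divr_gt0 e0 m1)) _.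
rewrite mulrAC ler_pdivrMr// -mulrA ler_pM2l//.
by rewrite ler_pdivrMl//; nra.
Qed.

End VectorMeasure.

(** * Topology of the torus *)

Section TorusTopology.
Context {R : realType} {d : nat}.
Implicit Types (x y q : 'rV[R]_d).

Local Notation torus := (torus R d).

Lemma tpi_eqP x y : tpi x = tpi y <-> forall i, x 0 i - y 0 i \is a Num.int.
Proof.
split => [/eqmodP/forallP //|h]; apply/eqmodP; exact/forallP.
Qed.

Lemma tpi_repr (z : torus) : tpi (repr z) = z.
Proof. exact: reprK. Qed.

Lemma tpi_continuous : continuous (@tpi R d).
Proof. exact: pi_continuous. Qed.

Lemma torus_continuous {Z : topologicalType} (f : torus -> Z) :
  continuous f <-> continuous (f \o tpi).
Proof. exact: quotient_continuous. Qed.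

Definition periodic_fun {Z : Type} (F : 'rV[R]_d -> Z) :=
  forall x y, tpi x = tpi y -> F x = F y.

Lemma periodic_repr {Z : Type} (F : 'rV[R]_d -> Z) : periodic_fun F ->
  (F \o repr) \o tpi = F.
Proof. by move=> pF; apply/funext => x /=; apply: pF; rewrite tpi_repr. Qed.

Lemma periodic_continuous {Z : topologicalType} (F : 'rV[R]_d -> Z) :
  periodic_fun F -> continuous F -> continuous (F \o repr : torus -> Z).
Proof. by move=> pF cF; apply/torus_continuous; rewrite periodic_repr. Qed.

(** Every lattice class meets the compact unit cube. *)
Lemma torus_compact : compact [set: torus].
Proof.
have -> : [set: torus] = @tpi R d @` [set v : 'rV[R]_d | forall i, `[0, 1]%classic (v ord0 i)].
  apply/seteqP; split => // z _.
  exists (\row_i (repr z 0 i - (Num.floor (repr z 0 i))%:~R)).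
    move=> i /=; rewrite mxE in_itv /= subr_ge0 floor_le_tmp/= lerBlDr addrC ltW//.
    by have := floorD1_gt (repr z 0 i); rewrite intrD.
  rewrite -[RHS]tpi_repr; apply/tpi_eqP => i; rewrite mxE addrAC subrr sub0r.
  by rewrite rpredN intr_int.
apply: continuous_compact.
  by apply: continuous_subspaceT; exact: tpi_continuous.
have h := @rV_compact R d (fun=> `[0, 1]%classic) (fun=> @segment_compact R 0 1).
exact: h.
Qed.

Lemma torus_continuous_measurable (f : torus -> R) : continuous f ->
  measurable_fun setT f.
Proof.
move=> /continuousP cf; apply: (measurability _ (RGenOInfty.measurableE R)).
move=> _ [_ [a ->] <-]; rewrite setTI; apply: sub_sigma_algebra; apply: cf.
exact: interval_open.
Qed.

Lemma torus_continuous_bdmeas (f : torus -> R) : continuous f -> bdmeas setT f.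
Proof.
move=> cf; split; first exact: torus_continuous_measurable.
have /compact_bounded[M [_ fM]] : compact (f @` setT).
  by apply: continuous_compact; [exact: continuous_subspaceT|exact: torus_compact].
by exists (M + 1) => z _; apply: (fM (M + 1)) => //; rewrite ltrDl.
Qed.

(** A substitute for the squared distance on the torus that is smooth and
    periodic, and satisfies the triangle inequality up to a factor. *)
Definition tdist2 q x : R := \sum_i sin (pi * (x 0 i - q 0 i)) ^+ 2.

Lemma sin2_periodic (u k : R) : k \is a Num.int ->
  sin (pi * (u + k)) ^+ 2 = sin (pi * u) ^+ 2.
Proof.
have nat_case (v : R) n : sin (pi * (v + n%:R)) ^+ 2 = sin (pi * v) ^+ 2.
  rewrite mulrDr mulr_natr alternatingn; last exact: sinDpi.
  by rewrite exprMn -exprM mulnC exprM sqrrN !expr1n mul1r.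
move=> /intrP[[n|n] ->]; first exact: nat_case.
by rewrite NegzE intrN; have := nat_case (u - n.+1%:R) n.+1; rewrite subrK => ->.
Qed.

Lemma tdist2_periodic q : periodic_fun (tdist2 q).
Proof.
move=> x y /tpi_eqP h; apply: eq_bigr => i _.
by rewrite -(sin2_periodic (y 0 i - q 0 i) (h i)); congr (sin (_ * _) ^+ 2); ring.
Qed.

Lemma tdist2_ge0 q x : 0 <= tdist2 q x.
Proof. by apply: sumr_ge0 => i _; exact: sqr_ge0. Qed.

Lemma tdist2_sym q x : tdist2 q x = tdist2 x q.
Proof.
by apply: eq_bigr => i _; rewrite -[RHS]sqrrN -sinN; congr (sin _ ^+ 2); ring.
Qed.

Lemma tdist2_triangle q x y : tdist2 q y <= 2 * (tdist2 q x + tdist2 x y).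
Proof.
rewrite -big_split mulr_sumr; apply: ler_sum => i _ /=.
have -> : pi * (y 0 i - q 0 i) = pi * (x 0 i - q 0 i) + pi * (y 0 i - x 0 i) :> R by ring.
set a := pi * _; set b := pi * (_ - x 0 i); rewrite sinD.
have ca := cos2sin2 a; have cb := cos2sin2 b.
have -> : (sin a * cos b + cos a * sin b) ^+ 2 =
    2 * (sin a ^+ 2 * cos b ^+ 2 + cos a ^+ 2 * sin b ^+ 2)
      - (sin a * cos b - cos a * sin b) ^+ 2 by ring.
rewrite lerBlDr ca cb; have := sqr_ge0 (sin a * cos b - cos a * sin b).
by have := sqr_ge0 (sin a * sin b); rewrite exprMn; nra.
Qed.

Lemma tdist2_eq0 q x : tdist2 q x = 0 -> tpi x = tpi q.
Proof.
move=> /eqP; rewrite psumr_eq0 => [/allP h|i _]; last exact: sqr_ge0.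
apply/tpi_eqP => i; have := h i (mem_index_enum i); rewrite sqrf_eq0.
set u := x 0 i - q 0 i => /implyP/(_ isT) su.
have := sin2_periodic (u - (Num.floor u)%:~R) (intr_int _ (Num.floor u)).
rewrite subrK (eqP su) expr0n/= => /esym/eqP; rewrite sqrf_eq0 => /eqP s0.
have u0 : 0 <= u - (Num.floor u)%:~R by rewrite subr_ge0 floor_le_tmp.
have u1 : u - (Num.floor u)%:~R < 1.
  by rewrite ltrBlDr addrC; have := floorD1_gt u; rewrite intrD.
have [uE|un] := eqVneq (u - (Num.floor u)%:~R) 0.
  by move/eqP: uE; rewrite subr_eq0 => /eqP ->; exact: intr_int.
suff : 0 < sin (pi * (u - (Num.floor u)%:~R)) by rewrite s0 ltxx.
apply: sin_gt0_pi; rewrite mulr_gt0 ?pi_gt0 ?lt0r ?un//=.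
by rewrite gtr_pMr ?pi_gt0.
Qed.

Lemma tdist2_continuous q : continuous (tdist2 q).
Proof.
apply: (@continuous_big _ _ +%R 0 xpredT (@add_continuous R)) => i _ x.
apply: (@continuous_comp _ _ _ (fun x' : 'rV[R]_d => x' 0 i)
  (fun r : R => sin (pi * (r - q 0 i)) ^+ 2)); first exact: coord_continuous.
set r := x 0 i; suff h : {for r, continuous (fun r' : R => sin (pi * (r' - q 0 i)))}.
  exact: (cvgM h h).
apply: (@continuous_comp _ _ _ (fun r' : R => pi * (r' - q 0 i)) sin).
  by apply: cvgMl_tmp; apply: cvgB; [exact: cvg_id|exact: cvg_cst].
exact: continuous_sin.
Qed.

Definition rball (p : 'rV[rat]_d * nat) : set torus :=
  [set z | tdist2 (map_mx ratr p.1) (repr z) < p.2.+1%:R^-1].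

(** The rational balls form a countable base. *)
Lemma rball_base (U : set torus) : open U ->
  U = \bigcup_(p in [set p | rball p `<=` U]) rball p.
Proof.
move=> oU; apply/seteqP; split => [z Uz|z [p pU]]; last exact: pU.
pose f := tdist2 (repr z) \o repr : torus -> R.
have cf : continuous f.
  by apply: periodic_continuous; [exact: tdist2_periodic|exact: tdist2_continuous].
(* The complement of U is compact, so the distance to z is bounded below on it. *)
have [e e0 fe] : exists2 e : R, 0 < e & forall x : torus, f x < e -> U x.
  have [/eqP U0|/set0P nU] := eqVneq (~` U) set0.
    by exists 1 => // x _; move: U0; rewrite -setCT => /eqP/setC_inj ->.
  have cU : compact (~` U).
    by apply: (subclosed_compact _ torus_compact) => //; exact: open_closedC.
  have [c /set_mem Uc cmin] := compact_EVT_min nU cU (continuous_subspaceT cf).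
  exists (f c).
    rewrite lt_neqAle tdist2_ge0 andbT eq_sym; apply/eqP => /tdist2_eq0.
    by rewrite !tpi_repr => cz; apply: Uc; rewrite cz.
  move=> x fx; apply: contrapT => /mem_set /cmin; by rewrite leNgt fx.
(* The factor 2 of the triangle inequality applies to a sum of two distances,
   each below the radius: hence e / 4. *)
have [n ne] : exists n : nat, n.+1%:R^-1 < e / 4.
  have e4 : 0 < e / 4 by rewrite divr_gt0.
  by have [N _ /(_ N (leqnn N))] := near_infty_natSinv_lt (PosNum e4); exists N.
have [q qz] : exists q : 'rV[rat]_d, tdist2 (map_mx ratr q) (repr z) < n.+1%:R^-1.
  have /choice[q qP] : forall i, exists q : rat,
      sin (pi * (repr z 0 i - ratr q)) ^+ 2 < n.+1%:R^-1 / d.+1%:R.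
    move=> i; set u := repr z 0 i.
    have c : continuous (fun r : R => sin (pi * (u - r)) ^+ 2).
      move=> r; suff h : {for r, continuous (fun r' : R => sin (pi * (u - r')))}.
        exact: (cvgM h h).
      apply: (@continuous_comp _ _ _ (fun r' : R => pi * (u - r')) sin).
        by apply: cvgMl_tmp; apply: cvgB; [exact: cvg_cst|exact: cvg_id].
      exact: continuous_sin.
    have dlt : sin (pi * (u - u)) ^+ 2 < n.+1%:R^-1 / d.+1%:R.
      by rewrite subrr mulr0 sin0 expr0n/= divr_gt0 ?invr_gt0 ?ltr0n.
    have nu : \forall r' \near u, sin (pi * (u - r')) ^+ 2 < n.+1%:R^-1 / d.+1%:R.
      exact: cvgr_lt (c u) _ dlt.
    have /nbhs_ballP[r /= r0 rb] := nu.
    have [q qr] : exists q : rat, ratr q \in `]u - r, u + r[.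
      by apply: rat_in_itvoo; rewrite ltrD2l gtrN.
    exists q; apply: rb; rewrite /ball/=.
    by move: qr; rewrite in_itv/= ltr_norml => /andP[q1 q2]; lra.
  exists (\row_i q i).
  apply: (@le_lt_trans _ _ (\sum_(i < d) n.+1%:R^-1 / d.+1%:R)).
    by apply: ler_sum => i _; rewrite !mxE ltW.
  rewrite sumr_const card_ord -[_ *+ d]mulr_natr -mulrA gtr_pMr ?invr_gt0 ?ltr0n//.
  by rewrite mulrC ltr_pdivrMr ?ltr0n// mul1r ltr_nat.
have qB : rball (q, n) `<=` U.
  move=> x; rewrite /rball/= => qx; apply: fe.
  apply: le_lt_trans (tdist2_triangle _ (map_mx ratr q) _) _.
  rewrite tdist2_sym; move: qz qx ne.
  by set a := tdist2 _ _; set b := tdist2 _ _; set c := n.+1%:R^-1; lra.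
by exists (q, n).
Qed.

End TorusTopology.

(** * Smooth test functions *)

Section Cutoff.
Context {R : realType}.
Implicit Types (a u t : R).

Definition C1fun (g g' : R -> R) := (forall t, is_derive t 1 g (g' t)) /\ continuous g'.

Lemma C1fun_continuous g g' : C1fun g g' -> continuous g.
Proof.
move=> [dg _] t; apply: differentiable_continuous; apply/derivable1_diffP.
by have [] := dg t.
Qed.

Lemma C1fun_cst c : C1fun (fun=> c) (fun=> 0).
Proof. by split => [t|]; [exact: is_derive_cst|move=> t; exact: cvg_cst]. Qed.

Lemma C1funM f f' g g' : C1fun f f' -> C1fun g g' ->
  C1fun (fun t => f t * g t) (fun t => f t * g' t + g t * f' t).
Proof.
move=> hf hg; split => [t|t].
  have ? := hf.1 t; have ? := hg.1 t; exact: (is_deriveM (f := f) (g := g)).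
have cf := C1fun_continuous hf; have cg := C1fun_continuous hg.
by apply: cvgD; apply: cvgM; (exact: cf || exact: cg || exact: hf.2 || exact: hg.2).
Qed.

Lemma C1fun_comp f f' g g' : C1fun f f' -> C1fun g g' ->
  C1fun (f \o g) (fun t => f' (g t) * g' t).
Proof.
move=> hf hg; split => [t|t].
  by apply: is_derive1_comp; [exact: hf.1|exact: hg.1].
apply: cvgM; last exact: hg.2.
by apply: (@continuous_comp _ _ _ g f'); [exact: C1fun_continuous hg t|exact: hf.2].
Qed.

Lemma C1fun_expR : C1fun (@expR R) (@expR R).
Proof. by split; [exact: is_derive_expR|exact: continuous_expR]. Qed.

Lemma C1fun_affine a c : C1fun (fun t => a + c * t) (fun=> c).
Proof.
split => [t|]; last by move=> t; exact: cvg_cst.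
have h : is_derive t 1 (fun t => c * t) c.
  exact: (is_derive_eq (@is_deriveZ _ _ _ id c t 1 1 _) (mulr1 c)).
exact: (is_derive_eq (@is_deriveD _ _ _ (cst a) (fun t => c * t) t 1 0 c _ h) (add0r c)).
Qed.

(** A smooth approximation of the indicator of [u < a]: the inner exponential
    tends to [0] for [u < a] and to infinity otherwise, the term [n%:R] deciding the
    case [u = a]. *)
Definition cutoff (n : nat) a u : R := expR (- expR (n%:R - n%:R ^+ 2 * (a - u))).

Lemma C1fun_cutoff n a : exists g', C1fun (cutoff n a) g'.
Proof.
have h1 := C1fun_affine (n%:R - n%:R ^+ 2 * a) (n%:R ^+ 2).
have h2 := C1fun_comp (C1fun_affine 0 (-1)) (C1fun_comp C1fun_expR h1).
have [h3 h4] := C1fun_comp C1fun_expR h2.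
eexists; split; last exact: h4.
have -> : cutoff n a = expR \o ((fun t => 0 + -1 * t) \o
    (expR \o (fun t => n%:R - n%:R ^+ 2 * a + n%:R ^+ 2 * t))).
  apply/funext => u; rewrite /cutoff/= add0r mulN1r; congr (expR (- expR _)); ring.
exact: h3.
Qed.

Lemma cutoff_itv n a u : 0 <= cutoff n a u <= 1.
Proof. by rewrite expR_ge0 /= -expR0 ler_expR oppr_le0 expR_ge0. Qed.

Lemma cutoff_cvg a u : cutoff n a u @[n --> \oo] --> ((u < a)%R%:R : R).
Proof.
have expN (x : R) : 0 <= x -> expR (- x) <= (1 + x)^-1.
  move=> x0; rewrite expRN lef_pV2 ?posrE ?expR_gt0 ?ltr_pwDl//; exact: expR_ge1Dx.
apply/cvgrPdist_le => e e0.
have small : \forall n \near \oo, (1 + n%:R)^-1 <= e.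
  near=> n; rewrite addrC natr1; apply/ltW.
  by near: n; exact: (near_infty_natSinv_lt (PosNum e0)).
case: (ltP u a) => [ua|au].
- have a0 : 0 < a - u by rewrite subr_gt0.
  near=> n; have ne : (1 + n%:R)^-1 <= e by near: n.
  have n2 : 2 <= n%:R * (a - u).
    by rewrite -ler_pdivrMr//; near: n; exact: nbhs_infty_ger.
  have n0 : 0 <= n%:R :> R by [].
  rewrite ger0_norm; last by rewrite subr_ge0; have /andP[] := cutoff_itv n a u.
  apply: le_trans ne; apply: le_trans (expN _ n0).
  have h : expR (n%:R - n%:R ^+ 2 * (a - u)) <= expR (- n%:R) :> R.
    by rewrite ler_expR; nra.
  apply: le_trans h; rewrite lerBlDr -lerBlDl; exact: expR_ge1Dx.
- near=> n; have ne : (1 + n%:R)^-1 <= e by near: n.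
  rewrite sub0r normrN ger0_norm ?expR_ge0//; apply: le_trans ne.
  have n0 : 0 <= n%:R :> R by [].
  apply: le_trans (expN _ n0); rewrite ler_expR lerN2.
  have -> : n%:R <= expR (n%:R - n%:R ^+ 2 * (a - u)) = true => //.
  apply: (@le_trans _ _ (expR n%:R)).
    by apply: le_trans (expR_ge1Dx _); rewrite lerDr.
  by rewrite ler_expR lerDl oppr_ge0 mulr_ge0_le0 ?sqr_ge0// subr_le0.
Unshelve. all: by end_near. Qed.

End Cutoff.

Lemma continuous_mulr {R : realType} {X : topologicalType} (f g : X -> R) :
  continuous f -> continuous g -> continuous (fun x => f x * g x).
Proof. by move=> cf cg x; apply: cvgM; [exact: cf|exact: cg]. Qed.

Lemma continuous_addr {R : realType} {X : topologicalType} (f g : X -> R) :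
  continuous f -> continuous g -> continuous (fun x => f x + g x).
Proof. by move=> cf cg x; apply: cvgD; [exact: cf|exact: cg]. Qed.

Section TestFunctions.
Context {R : realType} {d : nat}.
Local Notation torus := (torus R d).
Implicit Types (F : 'rV[R]_d -> R) (psi : torus -> R) (x y q v : 'rV[R]_d).

(** Makes the one-variable chain rule available for directional derivatives. *)
Lemma is_derive_line F x v df :
  is_derive (0 : R) 1 (fun h : R => F (h *: v + x)) df -> is_derive x v F df.
Proof.
move=> [h1 h2]; split; first exact/derivable1P.
have E : (fun h : R => h^-1 *: ((F \o shift x) (h *: v) - F x)) =
    (fun h : R => h^-1 *: (((fun h : R => F (h *: v + x)) \o shift 0) (h *: 1)
      - F (0 *: v + x))).
  by apply/funext => h /=; rewrite scale0r add0r addr0 [h *: 1]mulr1.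
by rewrite -h2 /derive E.
Qed.

(** The partial derivatives of a periodic function are periodic, hence descend
    to the torus with it. *)
Lemma Ck1_descend F (F' : 'I_d -> 'rV[R]_d -> R) :
  periodic_fun F -> continuous F ->
  (forall j y, is_derive y (delta_mx 0 j) F (F' j y)) ->
  (forall j, continuous (F' j)) -> Ck 1 (F \o repr : torus -> R).
Proof.
move=> pF cF dF cF'.
have lift := periodic_repr pF.
have pdE j : pd j (F \o repr : torus -> R) = F' j \o repr.
  by apply/funext => z; rewrite /pd lift; have [_ ->] := dF j (repr z).
split => [|j z|j].
- exact: periodic_continuous.
- by rewrite /has_pd lift; have [] := dF j (repr z).
- rewrite /= pdE; apply: periodic_continuous => //.
  move=> x y xy; have [_ <-] := dF j x; have [_ <-] := dF j y.
  have E : (fun h : R => h^-1 *: ((F \o shift x) (h *: delta_mx 0 j) - F x)) =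
      (fun h : R => h^-1 *: ((F \o shift y) (h *: delta_mx 0 j) - F y)).
    apply/funext => h /=; rewrite (pF _ _ xy) (pF (_ + x) (h *: delta_mx 0 j + y))//.
    apply/tpi_eqP => i; rewrite !mxE opprD addrACA subrr add0r.
    by move/tpi_eqP : xy; exact.
  by rewrite /derive E.
Qed.

Lemma Ck1_cst (c : R) : Ck 1 ((fun=> c) : torus -> R).
Proof.
apply: (@Ck1_descend (fun=> c) (fun _ _ => 0)) => //.
- exact: cst_continuous.
- by move=> j; exact: cst_continuous.
Qed.

Lemma Ck1_comp_tdist2 (g g' : R -> R) q : C1fun g g' ->
  Ck 1 (fun z : torus => g (tdist2 q (repr z))).
Proof.
move=> hg; have cg := C1fun_continuous hg.
pose s (u : R) := sin (pi * u) ^+ 2.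
pose s' (u : R) := 2 * sin (pi * u) * (pi * cos (pi * u)).
have ds (u : R) : is_derive u 1 s (s' u).
  have h1 : is_derive u 1 (fun u : R => sin (pi * u)) (pi * cos (pi * u)).
    rewrite mulrC; apply: (@is_derive1_comp _ sin (fun u => pi * u)).
    exact: (is_derive_eq (@is_deriveZ _ _ _ id pi u 1 1 _) (mulr1 pi)).
  have h2 := @is_deriveX _ _ (fun u : R => sin (pi * u)) 2 u 1 _ h1.
  by apply: (is_derive_eq h2); rewrite /s' /= expr1.
have cs' : continuous s'.
  move=> u; have c1 : {for u, continuous (fun u : R => pi * u)}.
    by apply: cvgMl_tmp; exact: cvg_id.
  have c2 : {for u, continuous (fun u : R => sin (pi * u))}.
    by apply: continuous_comp => //; exact: continuous_sin.
  have c3 : {for u, continuous (fun u : R => cos (pi * u))}.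
    by apply: continuous_comp => //; exact: continuous_cos.
  by apply: cvgM; apply: cvgMl_tmp.
apply: (@Ck1_descend (g \o tdist2 q) (fun j y => g' (tdist2 q y) * s' (y 0 j - q 0 j))).
- by move=> x y xy /=; rewrite (tdist2_periodic q xy).
- move=> y; apply: continuous_comp; [exact: tdist2_continuous|exact: cg].
- move=> j y; apply: is_derive_line.
  have fE : (fun h : R => (g \o tdist2 q) (h *: delta_mx 0 j + y)) =
      g \o (fun h => (tdist2 q y - s (y 0 j - q 0 j)) + s (h + (y 0 j - q 0 j))).
    apply/funext => h /=; congr g; rewrite /tdist2 (bigD1 j)//= [in RHS](bigD1 j)//=.
    rewrite !mxE !eqxx mulr1 addrC; congr (_ + _); last by rewrite /s addrA.
    rewrite [in RHS]addrAC subrr add0r; apply: eq_bigr => i ij.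
    by rewrite !mxE (negbTE ij) andbF mulr0 add0r.
  rewrite fE; have z0 : tdist2 q y - s (y 0 j - q 0 j) + s (0 + (y 0 j - q 0 j)) = tdist2 q y.
    by rewrite add0r subrK.
  apply: is_derive1_comp; first by rewrite z0; exact: hg.1.
  have h3 : is_derive (0 : R) 1 (fun h : R => s (h + (y 0 j - q 0 j))) (s' (y 0 j - q 0 j)).
    rewrite -[s' _]mulr1; apply: (@is_derive1_comp _ s (fun h => h + (y 0 j - q 0 j))).
      by rewrite add0r.
    exact: (is_derive_eq (@is_deriveD _ _ _ id (cst (y 0 j - q 0 j)) (0 : R) 1 1 0 _ _) (addr0 1)).
  exact: (is_derive_eq (@is_deriveD _ _ _ (cst _) (fun h => s (h + _)) (0 : R) 1 0 _ _ h3) (add0r _)).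
- move=> j; apply: continuous_mulr => y.
    by apply: (@continuous_comp _ _ _ (tdist2 q) g'); [exact: tdist2_continuous|exact: hg.2].
  apply: (@continuous_comp _ _ _ (fun y : 'rV[R]_d => y 0 j) (fun r => s' (r - q 0 j))).
    exact: coord_continuous.
  apply: (@continuous_comp _ _ _ (fun r => r - q 0 j) s'); last exact: cs'.
  by apply: cvgB; [exact: cvg_id|exact: cvg_cst].
Qed.

Context {T : R} (T0 : 0 < T).

(** As [T > 0], every time in the interval is an accumulation point of it, so
    that limits of difference quotients are unique. *)
Lemma within_proper (t : R) : t \in `[0, T] -> ProperFilter (within `[0, T] t^').
Proof.
rewrite in_itv/= => /andP[t0 tT]; apply: Build_ProperFilter_ex => P.
move=> /nbhs_ballP[e /= e0 eP].
have [tT'|tT'] := ltP t T.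
  pose h := Num.min (e / 2) (T - t).
  have h0 : 0 < h by rewrite lt_min divr_gt0//= subr_gt0.
  exists (t + h); apply: eP => /=.
  - rewrite /ball/= opprD addrA subrr sub0r normrN gtr0_norm//.
    by rewrite gt_min ltr_pdivrMr// ltr_pMr// ltr1n.
  - by rewrite -subr_eq0 addrAC subrr add0r gt_eqF.
  - rewrite in_itv/=; apply/andP; split; first by rewrite addr_ge0// ltW.
    by rewrite -lerBrDl /h ge_min lexx orbT.
  have tE : t = T by apply/eqP; rewrite eq_le tT tT'.
  pose h := Num.min (e / 2) T.
  have h0 : 0 < h by rewrite lt_min divr_gt0.
  exists (t - h); apply: eP => /=.
  - rewrite /ball/= opprB addrC subrK gtr0_norm//.
    by rewrite gt_min ltr_pdivrMr// ltr_pMr// ltr1n.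
  - by rewrite -subr_eq0 addrAC subrr add0r oppr_eq0 gt_eqF.
  - by rewrite in_itv/= tE subr_ge0 /h ge_min lexx orbT/= gerBl ltW.
Qed.

Lemma tquot_cvg (g : R -> R) (t dg : R) : is_derive t 1 g dg ->
  tquot g t s @[s --> within `[0, T] t^'] --> dg.
Proof.
move=> [dgt <-]; have shift : (fun s => s - t) @ within `[0, T] t^' --> 0^'.
  move=> P /nbhs_ballP[e /= e0 eP]; apply/nbhs_ballP; exists e => //= s ts st _.
  apply: eP; last by rewrite subr_eq0.
  by move: ts; rewrite /ball/= sub0r normrN distrC.
have := cvg_comp _ _ shift dgt; rewrite -/(derive g t 1) => h.
apply: cvg_trans h; apply: near_eq_cvg; apply: nearW => s.
by rewrite /tquot /= [(s - t) *: 1]mulr1 subrK.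
Qed.

Lemma dtimeE (g : R -> R) (t dg : R) : t \in `[0, T] -> is_derive t 1 g dg ->
  has_dtime T g t /\ dtime T g t = dg.
Proof.
move=> tT dgt; have pf := within_proper tT; have c := tquot_cvg dgt; split.
  by apply/cvg_ex; exists dg.
exact: cvg_lim.
Qed.

Lemma C1st_prod (g g' : R -> R) psi : C1fun g g' -> Ck 1 psi ->
  C1st T (fun t (x : torus) => g t * psi x).
Proof.
move=> hg [cpsi dpsi cdpsi]; have cg := C1fun_continuous hg.
have dt (t : R) (x : torus) : is_derive t 1 (fun s => g s * psi x) (g' t * psi x).
  have [/(_ t) h _] := C1funM hg (C1fun_cst (psi x)).
  by apply: (is_derive_eq h); rewrite mulr0 add0r mulrC.
have pdE j (t : R) : pd j (fun x : torus => g t * psi x) = (fun x : torus => g t * pd j psi x).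
  apply/funext => x; rewrite /pd -[RHS]/(g t *: _) -deriveZ//; exact: dpsi.
have cprod (f : R -> R) (phi : torus -> R) : continuous f -> continuous phi ->
    {within @cylinder R d T, continuous (fun z => f z.1 * phi z.2)}.
  move=> cf cphi; apply: continuous_subspaceT => z; apply: cvgM.
    by apply: (@continuous_comp _ _ _ fst f); [exact: cvg_fst|exact: cf].
  by apply: (@continuous_comp _ _ _ snd phi); [exact: cvg_snd|exact: cphi].
split.
- exact: cprod.
- by move=> t x tT; have [] := dtimeE tT (dt t x).
- move=> j t x tT; apply: (@derivableZ _ _ _ (psi \o tpi) (g t)); exact: dpsi.
- apply: subspace_eq_continuous (cprod g' psi hg.2 cpsi) => z /set_mem[/= zT _].
  by have [_ h] := dtimeE zT (dt z.1 z.2); exact: esym.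
- move=> j; under eq_fun do rewrite pdE; exact: cprod.
Qed.

(** All trial fields other than the smooth solution are of this form. *)
Lemma C1fieldst_prod (g g' : R -> R) psi i : C1fun g g' -> Ck 1 psi ->
  C1fieldst T (fun t (x : torus) => (g t * psi x) *: delta_mx 0 i : 'rV[R]_d).
Proof.
move=> hg hpsi j.
have hd := C1funM (C1fun_cst ((delta_mx 0 i : 'rV[R]_d) 0 j)) hg.
have := C1st_prod hd hpsi.
rewrite (_ : (fun t (x : torus) => _ * _ * psi x) =
    (fun t (x : torus) => ((g t * psi x) *: delta_mx 0 i : 'rV[R]_d) 0 j)) //.
by apply/funext => t; apply/funext => x; rewrite !mxE; ring.
Qed.

End TestFunctions.

(** * A generating pi-system *)

Section PiSystem.
Context {R : realType} {d : nat}.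
Local Notation torus := (torus R d).

Lemma Ck1M (f g : torus -> R) : Ck 1 f -> Ck 1 g -> Ck 1 (fun x => f x * g x).
Proof.
move=> [cf df cdf] [cg dg cdg]; split => [|j x|j].
- exact: continuous_mulr.
- exact: (@derivableM _ _ (f \o tpi) (g \o tpi) _ _ (df j x) (dg j x)).
- have -> : pd j (fun x => f x * g x) = (fun x => f x * pd j g x + g x * pd j f x).
    apply/funext => x; rewrite /pd (@deriveM _ _ (f \o tpi) (g \o tpi) _ _ (df j x) (dg j x)).
    by rewrite /= tpi_repr.
  have c1 : continuous (fun x => f x * pd j g x) by apply: continuous_mulr => //; exact: cdg.
  have c2 : continuous (fun x => g x * pd j f x) by apply: continuous_mulr => //; exact: cdf.
  exact: continuous_addr c1 c2.
Qed.

(** Asking for bounded pointwise approximation by [C^1] functions, rather than for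
    sets of a given shape, makes stability under intersection immediate. *)
Definition approx_time (A : set R) := exists chi dchi : nat -> R -> R,
  [/\ forall n, C1fun (chi n) (dchi n), forall n t, 0 <= chi n t <= 1 &
      forall t, chi n t @[n --> \oo] --> (\1_A t : R)].

Definition approx_torus (U : set torus) := exists psi : nat -> torus -> R,
  [/\ forall n, Ck 1 (psi n), forall n x, 0 <= psi n x <= 1 &
      forall x, psi n x @[n --> \oo] --> (\1_U x : R)].

Lemma approx_time_measurable A : approx_time A -> measurable A.
Proof.
move=> [chi [dchi [hchi _ chiA]]]; apply/(measurable_indicP R).
apply: (measurable_fun_cvg (h := chi)) => [n|t _]; last exact: chiA.
by apply: continuous_measurable_fun; exact: C1fun_continuous (hchi n).
Qed.

Lemma approx_torus_measurable U : approx_torus U -> measurable U.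
Proof.
move=> [psi [hpsi _ psiU]]; apply/(measurable_indicP R).
apply: (measurable_fun_cvg (h := psi)) => [n|t _]; last exact: psiU.
by apply: torus_continuous_measurable; case: (hpsi n).
Qed.

Lemma approx_timeT : approx_time setT.
Proof.
exists (fun _ _ => 1), (fun _ _ => 0); split => [n|n t|t].
- exact: C1fun_cst.
- by rewrite ler01 lexx.
- by rewrite indicT; exact: cvg_cst.
Qed.

Lemma approx_torusT : approx_torus setT.
Proof.
exists (fun _ _ => 1); split => [n|n t|t].
- exact: Ck1_cst.
- by rewrite ler01 lexx.
- by rewrite indicT; exact: cvg_cst.
Qed.

Lemma mul_itv01 (a b : R) : 0 <= a <= 1 -> 0 <= b <= 1 -> 0 <= a * b <= 1.
Proof. by move=> /andP[a0 a1] /andP[b0 b1]; rewrite mulr_ge0// mulr_ile1. Qed.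

Lemma approx_timeI : setI_closed approx_time.
Proof.
move=> A A' [f [f' [hf f01 fA]]] [g [g' [hg g01 gA]]].
exists (fun n t => f n t * g n t), (fun n t => f n t * g' n t + g n t * f' n t).
split => [n|n t|t].
- exact: C1funM.
- exact: mul_itv01.
- by rewrite indicI; apply: cvgM; [exact: fA|exact: gA].
Qed.

Lemma approx_torusI : setI_closed approx_torus.
Proof.
move=> A A' [f [hf f01 fA]] [g [hg g01 gA]].
exists (fun n t => f n t * g n t); split => [n|n t|t].
- exact: Ck1M.
- exact: mul_itv01.
- by rewrite indicI; apply: cvgM; [exact: fA|exact: gA].
Qed.

Lemma approx_time_ray (a : R) : approx_time `]-oo, a[%classic.
Proof.
have /choice[chi' h] := fun n => @C1fun_cutoff R n a.
exists (fun n => cutoff n a), chi'; split => // [n t|t]; first exact: cutoff_itv.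
have -> : \1_(`]-oo, a[%classic) t = (t < a)%R%:R :> R.
  by rewrite indicE; congr (nat_of_bool _)%:R; apply/idP/idP; rewrite inE/= in_itv.
exact: cutoff_cvg.
Qed.

Lemma approx_torus_rball p : approx_torus (rball p).
Proof.
pose q : 'rV[R]_d := map_mx ratr p.1; pose r : R := p.2.+1%:R^-1.
exists (fun n z => cutoff n r (tdist2 q (repr z))); split => [n|n z|z].
- have [g' hg] := @C1fun_cutoff R n r; exact: Ck1_comp_tdist2 hg.
- exact: cutoff_itv.
- have -> : \1_(rball p) z = (tdist2 q (repr z) < r)%R%:R :> R.
    by rewrite indicE; congr (nat_of_bool _)%:R; apply/idP/idP; rewrite inE.
  exact: cutoff_cvg.
Qed.

Definition approx_rect : set (set (R * torus)) :=
  [set A `*` U | A in approx_time & U in approx_torus].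

Lemma approx_rectI : setI_closed approx_rect.
Proof.
move=> _ _ [A hA [U hU <-]] [A' hA' [U' hU' <-]].
exists (A `&` A'); first exact: approx_timeI.
exists (U `&` U'); first exact: approx_torusI.
by rewrite setXI.
Qed.

(** Half-lines generate the Borel sets in time, and the rational balls, which
    form a countable base, generate them in space. *)
Lemma measurable_approx_rect :
  @measurable _ (R * torus)%type = <<s approx_rect >>.
Proof.
pose S := g_sigma_algebraType approx_rect.
have mfst : measurable_fun setT (fst : S -> R).
  apply: (measurability _ (RGenInftyO.measurableE R)) => _ [_ [a ->] <-].
  rewrite setTI; apply: sub_sigma_algebra.
  exists `]-oo, a[%classic; first exact: approx_time_ray.
  by exists setT; [exact: approx_torusT|apply/seteqP; split => // x []].
have msnd : measurable_fun setT (snd : S -> torus).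
  apply: (@measurability _ _ _ _ _ _ (@open torus)) => // _ [U oU <-].
  rewrite setTI (rball_base oU) preimage_bigcup bigcup_mkcond.
  apply: countable_bigcupT_measurable; first exact: countableP.
  move=> p; case: ifP => // _; apply: sub_sigma_algebra.
  exists setT; first exact: approx_timeT.
  exists (rball p); first exact: approx_torus_rball.
  by apply/seteqP; split => // x [].
apply/seteqP; split; last first.
  apply: smallest_sub; first exact: sigma_algebra_measurable.
  move=> _ [A hA [U hU <-]]; apply: measurableX.
    exact: approx_time_measurable.
  exact: approx_torus_measurable.
rewrite measurable_prod_measurableType; apply: smallest_sub; first exact: smallest_sigma_algebra.
move=> _ [A mA [U mU <-]].
have -> : A `*` U = (setT `&` fst @^-1` A) `&` (setT `&` snd @^-1` U).
  by rewrite !setTI.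
apply: (@measurableI _ S); [exact: mfst|exact: msnd].
Qed.

End PiSystem.

(** * Continuity in time *)

Section TimeContinuity.
Context {R : realType} {d : nat}.
Local Notation torus := (torus R d).
Implicit Types (T : R) (f g : R -> torus -> R).

Definition cont_st T f :=
  {within @cylinder R d T, continuous (fun z => f z.1 z.2)}.

Lemma cont_stP T f : cont_st T f <->
  forall t x, t \in `[0, T] ->
    f z.1 z.2 @[z --> within (cylinder T) (nbhs (t, x))] --> f t x.
Proof.
split => [/subspace_continuousP h t x tT|h].
  by apply: (h (t, x)).
by apply/subspace_continuousP => -[t x] [/= tT _]; exact: h.
Qed.

Lemma cont_st_slice T f t : cont_st T f -> t \in `[0, T] -> continuous (f t).
Proof.
move=> /cont_stP cf tT x; have c := cf t x tT.
have h : (fun y : torus => (t, y)) @ x --> within (cylinder T) (nbhs (t, x)).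
  move=> P hP; have : \forall y \near x, cylinder T (t, y) -> P (t, y).
    by apply: (cvg_pair (cvg_cst t) (@cvg_id _ (nbhs x))) hP.
  by apply: filterS => y; apply.
exact: (cvg_comp _ _ h c).
Qed.

Lemma cont_stM T f g : cont_st T f -> cont_st T g ->
  cont_st T (fun t x => f t x * g t x).
Proof.
move=> /cont_stP cf /cont_stP cg; apply/cont_stP => t x tT.
by apply: cvgM; [exact: cf|exact: cg].
Qed.

Lemma cont_st_prod T (g : R -> R) (psi : torus -> R) : continuous g -> continuous psi ->
  cont_st T (fun t x => g t * psi x).
Proof.
move=> cg cpsi; apply: continuous_subspaceT; apply: continuous_mulr => z.
  by apply: (@continuous_comp _ _ _ fst g); [exact: cvg_fst|exact: cg].
by apply: (@continuous_comp _ _ _ snd psi); [exact: cvg_snd|exact: cpsi].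
Qed.

Lemma cont_st_bounded T f : cont_st T f ->
  exists M : R, forall t x, t \in `[0, T] -> `|f t x| <= M.
Proof.
move=> cf; have cc : compact (@cylinder R d T).
  by apply: compact_setX; [exact: segment_compact|exact: torus_compact].
have /compact_bounded[M [_ fM]] := continuous_compact cf cc.
exists (M + 1) => t x tT; apply: (fM (M + 1)); first by rewrite ltrDl.
by exists (t, x).
Qed.

(** Compactness of the torus makes the modulus of continuity in time uniform
    in space. *)
Lemma cont_st_uniform T f t0 e : cont_st T f -> t0 \in `[0, T] -> 0 < e ->
  \forall t \near within `[0, T] (nbhs t0), forall x, `|f t x - f t0 x| <= e.
Proof.
move=> cf t0T e0; have /compact_near_coveringP nc := @torus_compact R d.
pose P t (x : torus) := `|f t x - f t0 x| <= e.
suff : \forall t \near within `[0, T] (nbhs t0), [set: torus] `<=` P t.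
  by apply: filterS => t h x; exact: h.
apply: nc => x _.
have e2 : 0 < e / 2 by rewrite divr_gt0.
have c0 := cont_st_slice cf t0T.
have /cvgrPdist_le/(_ _ e2) n0 := c0 x.
move/cont_stP : cf => /(_ t0 x t0T)/cvgrPdist_le/(_ _ e2).
move=> [[A C] /= [A0 Cx] AC].
exists (C `&` (fun y => `|f t0 x - f t0 y| <= e / 2),
        (fun t => A t /\ t \in `[0, T])) => //=.
  by split; [exact: filterI|apply: filterS A0 => t At tT; split].
move=> [y t] [/= [Cy xy] [At tT]]; rewrite /P.
have h : `|f t0 x - f t y| <= e / 2 by apply: (AC (t, y)).
rewrite -(subrKA (f t0 x)) (le_trans (ler_normD _ _))// [leRHS](splitr e) lerD//.
by rewrite distrC.
Qed.

Context {n : nat}.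

(** The integrand moves little uniformly in space while the masses stay bounded,
    so weak-* continuity extends to integrands that depend on time. *)
Lemma cintegral_time_continuous T (B : R -> vmeasure torus R n) i f M :
  (forall phi : torus -> R, continuous phi ->
     {within `[0, T], continuous (fun t => cintegral (B t i) setT phi)}) ->
  (forall t, t \in `[0, T] -> fine (totvar (B t) setT) <= M) ->
  cont_st T f ->
  {within `[0, T], continuous (fun t => cintegral (B t i) setT (f t))}.
Proof.
move=> cB BM cf; apply/subspace_continuousP => t0 t0T.
apply/cvgrPdist_le => e e0.
have M1 : 0 < `|M| + 1 by rewrite ltr_pwDr.
pose de := e / 2 / (`|M| + 1).
have de0 : 0 < de by rewrite !divr_gt0.
have e2 : 0 < e / 2 by rewrite divr_gt0.
have cf0 := cont_st_slice cf t0T.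
have /subspace_continuousP/(_ _ t0T)/cvgrPdist_le/(_ _ e2) n1 := cB _ cf0.
have n2 := cont_st_uniform cf t0T de0.
have n3 : \forall t \near within `[0, T] (nbhs t0), t \in `[0, T].
  exact: withinT.
near=> t.
have tT : t \in `[0, T] by near: t.
have bf s : s \in `[0, T] -> bdmeas setT (f s).
  by move=> sT; apply: torus_continuous_bdmeas; exact: cont_st_slice cf sT.
rewrite -(subrKA (cintegral (B t i) setT (f t0))).
rewrite (le_trans (ler_normD _ _))// [leRHS](splitr e) lerD//; first by near: t.
have -> : cintegral (B t i) setT (f t0) - cintegral (B t i) setT (f t) =
    cintegral (B t i) setT (fun x => f t0 x + -1 * f t x).
  by rewrite cintegralD ?cintegralZ ?mulN1r//; try exact: bf; exact/bdmeasZ/bf.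
apply: (@le_trans _ _ (de * fine (totvar (B t) setT))).
  apply: cintegral_le_totvar.
    by apply: bdmeasD; [exact: bf|exact/bdmeasZ/bf].
  have h : forall x, `|f t x - f t0 x| <= de by near: t.
  by move=> x; rewrite mulN1r distrC.
rewrite /de mulrAC ler_pdivrMr// ler_pM2l//.
by apply: le_trans (BM _ tT) _; rewrite (le_trans (ler_norm _))// lerDl.
Unshelve. all: by end_near. Qed.

End TimeContinuity.

(** * A functional monotone class theorem *)

(** Dynkin's lemma extends [Q] from indicators of sets in [G] to all indicators,
    and rounding extends it further to bounded measurable functions. *)
Lemma monotone_class {dX : measure_display} {X : measurableType dX} {R : realType}
    (G : set (set X)) (Q : (X -> R) -> Prop) :
  @measurable _ X = <<s G >> -> setI_closed G -> G setT ->
  (forall E, G E -> Q \1_E) ->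
  (forall f g, bdmeas setT f -> bdmeas setT g -> Q f -> Q g -> Q (fun x => f x + g x)) ->
  (forall c f, bdmeas setT f -> Q f -> Q (fun x => c * f x)) ->
  (forall (F : nat -> X -> R) f (M : R), (forall n, bdmeas setT (F n)) -> (forall n, Q (F n)) ->
     (forall n x, `|F n x| <= M) -> (forall x, F ^~ x @ \oo --> f x) -> Q f) ->
  forall f, bdmeas setT f -> Q f.
Proof.
move=> GE GI GT QG QD QZ Qlim; apply: bdmeas_ind => // E mE.
have h1 (A : set X) : measurable A -> bdmeas setT (\1_A : X -> R) by exact: bdmeas_indic.
apply: (@dynkin_induction _ X G (fun E => Q \1_E)) => //.
- exact: QG.
- move=> A mA QA; have -> : \1_(~` A) = (fun x => \1_setT x + -1 * \1_A x) :> (X -> R).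
    apply/funext => x; rewrite !indicE in_setC in_setT mulN1r.
    by case: (x \in A); rewrite ?subrr ?subr0.
  by apply: QD; [exact: h1|exact/bdmeasZ/h1|exact: QG|apply: QZ => //; exact: h1].
- move=> A mA tA QA; apply: (Qlim (fun n => \1_(\big[setU/set0]_(k < n) A k)) _ 1).
  + by move=> n; apply/h1; exact: bigsetU_measurable.
  + elim=> [|n IH].
      have -> : \1_(\big[setU/set0]_(k < 0) A k) = (fun x => 0 * \1_setT x) :> (X -> R).
        by apply/funext => x; rewrite big_ord0 mul0r indic0.
      by apply: QZ; [exact: h1|exact: QG].
    have -> : \1_(\big[setU/set0]_(k < n.+1) A k) =
        (fun x => \1_(\big[setU/set0]_(k < n) A k) x + \1_(A n) x) :> (X -> R).
      apply/funext => x; rewrite big_ord_recr/= !indicE in_setU.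
      have [xn|//] := boolP (x \in A n); last by rewrite orbF addr0.
      rewrite orbT (_ : x \in \big[setU/set0]_(k < n) A k = false) ?add0r//.
      apply/negbTE/negP => /set_mem; rewrite -bigcup_mkord => -[k /= kn Akx].
      have /(tA _ _ I I) kE : A k `&` A n !=set0 by exists x; split => //; exact: set_mem.
      by rewrite kE ltnn in kn.
    by apply: QD => //; apply/h1 => //; exact: bigsetU_measurable.
  + by move=> n x; rewrite indicE; case: (_ \in _); rewrite ?normr1 ?normr0.
  + move=> x; have [[k _ Akx]|nx] := pselect ((\bigcup_k A k) x).
      apply: cvg_near_cst; near=> n.
      have m1 : x \in \bigcup_k A k by apply/mem_set; exists k.
      have m2 : x \in \big[setU/set0]_(j < n) A j.
        apply/mem_set; rewrite -bigcup_mkord; exists k => //=.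
        by near: n; exact: nbhs_infty_gt.
      by rewrite !indicE m1 m2.
    apply: cvg_near_cst; apply: nearW => n; rewrite !indicE !memNset//.
    by rewrite -bigcup_mkord => -[k _ Akx]; apply: nx; exists k.
- by rewrite -GE.
Unshelve. all: by end_near. Qed.


(** * Decay of the defect *)

Section Dissipation.
Context {R : realType} {d : nat} {T : R} {K1 K2 : R -> R -> R}
  {cstar : stfield R d -> stfield R d -> R}
  {B : R -> vmeasure (torus R d) R d} {P : vmeasure (R * torus R d)%type R d}.
Context (T0 : 0 < T) (hD : dissipative_solution T K1 K2 cstar (B 0) B P).
Local Notation torus := (torus R d).
Implicit Types (b v : stfield R d).

Lemma C1fieldst_cont b i : C1fieldst T b -> cont_st T (fun t x => b t x 0 i).
Proof. by move=> /(_ i)[]. Qed.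

Lemma C1fieldst_bdfield b t : C1fieldst T b -> t \in `[0, T] -> bdfield (b t).
Proof.
move=> hb tT i; apply: torus_continuous_bdmeas.
exact: (cont_st_slice (C1fieldst_cont (i := i) hb) tT).
Qed.

Lemma unit_field_enorm b t x : unit_field T b -> t \in `[0, T] -> enorm (b t x) = 1.
Proof. by move=> ub tT; rewrite /enorm ub// sqrtr1. Qed.

Lemma eta_integralE (nu : vmeasure torus R d) w k : bdfield w ->
  eta_integral nu w (fun=> k) = k * (fine (totvar nu setT) - vintegral nu setT w).
Proof. by move=> hw; rewrite /eta_integral vintegralZ// Rintegral_cst// mulrBr. Qed.

Lemma eta_integral1 (nu : vmeasure torus R d) w : bdfield w ->
  eta_integral nu w (cst 1) = fine (totvar nu setT) - vintegral nu setT w.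
Proof. by move=> hw; rewrite -[RHS]mul1r -eta_integralE. Qed.

Lemma eta_integral_cst (nu : vmeasure torus R d) w k : bdfield w ->
  eta_integral nu w (fun=> k) = k * eta_integral nu w (cst 1).
Proof. by move=> hw; rewrite eta_integral1// eta_integralE. Qed.

Lemma eta_integral_ge0 (nu : vmeasure torus R d) w : bdfield w ->
  (forall x, enorm (w x) = 1) -> 0 <= eta_integral nu w (cst 1).
Proof.
move=> hw w1; rewrite eta_integral1// subr_ge0 -[leRHS]mul1r -Rintegral_cst//.
by apply: vintegral_le => // [|x]; [exact: bdmeas_cst|rewrite w1].
Qed.

Lemma zero_field_C1 : C1fieldst T (fun _ _ => 0 : 'rV[R]_d).
Proof.
case: (posnP d) => [d0 i|d0].
  by exfalso; move: (ltn_ord i); rewrite [X in (_ < X)%N]d0 ltn0.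
have := C1fieldst_prod T0 (Ordinal d0) (C1fun_cst 0) (Ck1_cst (d := d) 0).
congr C1fieldst; apply/funext => t; apply/funext => x.
by rewrite mul0r scale0r.
Qed.

Lemma vintegral_zero dX (X : measurableType dX) (nu : vmeasure X R d) D (w : X -> 'rV[R]_d) :
  measurable D -> (forall x, D x -> w x = 0) -> vintegral nu D w = 0.
Proof.
move=> mD w0; rewrite /vintegral big1// => i _.
rewrite -[RHS](cintegral0 (nu i) mD); apply: eq_cintegral => x /set_mem Dx.
by rewrite w0// mxE.
Qed.

Lemma measurable_cylinder (t : R) : measurable (@cylinder R d t).
Proof. by apply: measurableX. Qed.

Lemma sub_itv (t s : R) : t \in `[0, T] -> s \in `[0, t] -> s \in `[0, T].
Proof.
rewrite !in_itv/= => /andP[t0 tT] /andP[s0 st]; rewrite s0/=; exact: le_trans st tT.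
Qed.

(** For [A = 0] and [L2 = L3 = 0] the integrand in time of the dissipation
    inequality reduces to [expR (- (r * s)) * (r - c)] times the defect, where [c]
    is the value of [cstar]; this is nonnegative as soon as [c <= r]. *)
Lemma defect_decay b v : C1fieldst T b -> C1fieldst T v -> unit_field T b ->
  (forall t x, t \in `[0, T] -> L2 T b v t x = 0) ->
  (forall t x, t \in `[0, T] -> L3 b v t x = 0) ->
  exists r : R, forall t, t \in `[0, T] ->
    expR (- (r * t)) * eta_integral (B t) (b t) (cst 1) <= eta_integral (B 0) (b 0) (cst 1).
Proof.
move=> hb hv ub L20 L30.
pose c := cstar b v.
pose r := Num.max c (c + 1 ^+ 2 / 2 + 1 * supnorm T v).
exists r => t tT.
have s0 : supnorm T (fun _ _ => 0 : 'rV[R]_d) <= 1.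
  apply: ge_sup.
    exists (enorm (0 : 'rV[R]_d)); exists (0, point) => //; split => //=.
    by rewrite in_itv/= lexx ltW.
  by move=> _ [z _ <-]; rewrite enorm0.
have rle : c + 1 ^+ 2 / 2 + 1 * supnorm T v <= r by rewrite le_max lexx orbT.
have := ds_dissipation hD (@ltr01 R) tT hb hv zero_field_C1 ub s0 rle.
rewrite /= (vintegral_zero _ (measurable_cylinder t)); last first.
  move=> [s x] [/= st _]; rewrite L30; last exact: sub_itv st.
  by rewrite subrr scaler0.
rewrite addr0; apply: le_trans; rewrite lerDl; apply: Rintegral_ge0 => s st.
have sT : s \in `[0, T] by exact: sub_itv st.
rewrite mulr_ge0 ?expR_ge0//.
have h0 x : dot (0 : 'rV[R]_d) (0 + 2 *: v s x) / 2 = 0.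
  by rewrite /dot big1 ?mul0r// => i _; rewrite mxE mul0r.
have -> : (fun x => r - c - dot (0 : 'rV[R]_d) (0 + 2 *: v s x) / 2) = (fun=> r - c).
  by apply/funext => x; rewrite h0 subr0.
rewrite (vintegral_zero _ measurableT) ?subr0; last first.
  by move=> x _; rewrite h0 scale0r addr0 L20.
rewrite eta_integral_cst; last exact: C1fieldst_bdfield.
apply: mulr_ge0; first by rewrite subr_ge0 /r le_max lexx.
apply: eta_integral_ge0; first exact: C1fieldst_bdfield.
by move=> x; exact: unit_field_enorm.
Qed.

Lemma pd_cst j (c : R) (x : torus) : pd j (fun=> c) x = 0.
Proof. exact: derive_cst. Qed.

Lemma dtimev_cst (w : 'rV[R]_d) t (x : torus) : t \in `[0, T] ->
  dtimev T (fun _ _ => w) t x = 0.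
Proof.
move=> tT; apply/rowP => i; rewrite !mxE.
by have [_ ->] := dtimeE T0 tT (is_derive_cst (w 0 i) t 1).
Qed.

(** Constant fields, with zero velocity, satisfy [L2 = L3 = 0], and the defects
    with respect to two opposite unit vectors add up to twice the mass. *)
Lemma mass_bounded : (0 < d)%N -> exists M : R,
  forall t, t \in `[0, T] -> fine (totvar (B t) setT) <= M.
Proof.
move=> d0; pose i0 := Ordinal d0.
pose e (s : R) : stfield R d := fun _ _ => s *: delta_mx 0 i0.
pose z : stfield R d := fun _ _ => 0.
have he s : C1fieldst T (e s).
  have := C1fieldst_prod T0 i0 (C1fun_cst s) (Ck1_cst (d := d) 1).
  congr C1fieldst; apply/funext => t; apply/funext => x.
  by rewrite mulr1.
have hs s : s ^+ 2 = 1 -> exists r : R, forall t, t \in `[0, T] ->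
    expR (- (r * t)) * eta_integral (B t) (e s t) (cst 1) <= eta_integral (B 0) (e s 0) (cst 1).
  move=> s1; apply: (@defect_decay (e s) z) => //.
  - exact: zero_field_C1.
  - move=> t x tT; rewrite /dot (bigD1 i0)//= big1 ?addr0 => [|j ji].
      by rewrite !mxE !eqxx mulr1 -expr2.
    by rewrite !mxE (negbTE ji) andbF mulr0 mul0r.
  - move=> t x tT; rewrite /L2 dtimev_cst// oppr0 add0r.
    have adv0 (a : 'rV[R]_d) (w : 'rV[R]_d) : adv a (fun=> w) x = 0.
      by apply/rowP => i; rewrite !mxE /advs big1// => j _; rewrite pd_cst mulr0.
    rewrite /e /z !adv0 oppr0 !add0r /advs [X in _ - X *: _]big1 => [|j _]; last by rewrite pd_cst mulr0.
    rewrite scale0r subr0 /dot big1 ?scale0r// => i _.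
    by rewrite mxE mul0r.
  - move=> t x tT; rewrite /L3 /z oppr0 add0r.
    by apply/rowP => i; rewrite !mxE /advs big1// => j _; rewrite pd_cst mulr0.
have sqN1 : (-1) ^+ 2 = 1 :> R by rewrite sqrrN expr1n.
have [r1 h1] := hs 1 (expr1n _ _); have [r2 h2] := hs (-1) sqN1.
exists ((expR (`|r1| * T) * eta_integral (B 0) (e 1 0) (cst 1)
      + expR (`|r2| * T) * eta_integral (B 0) (e (-1) 0) (cst 1)) / 2).
move=> t tT; have he0 s : bdfield (e s t) by exact: C1fieldst_bdfield.
have key s r : s ^+ 2 = 1 ->
   expR (- (r * t)) * eta_integral (B t) (e s t) (cst 1) <= eta_integral (B 0) (e s 0) (cst 1) ->
   eta_integral (B t) (e s t) (cst 1) <= expR (`|r| * T) * eta_integral (B 0) (e s 0) (cst 1).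
  have g0 u : u \in `[0, T] -> s ^+ 2 = 1 -> 0 <= eta_integral (B u) (e s u) (cst 1).
    move=> uT s1; apply: eta_integral_ge0; first exact: C1fieldst_bdfield.
    move=> x; rewrite /enorm /dot (bigD1 i0)//= big1 ?addr0 => [|j ji].
      by rewrite !mxE !eqxx mulr1 -expr2 s1 sqrtr1.
    by rewrite !mxE (negbTE ji) andbF mulr0 mul0r.
  move=> s1 h; move: (tT); rewrite in_itv/= => /andP[t0 tT'].
  have T0T : 0 \in `[0, T] by rewrite in_itv/= lexx ltW.
  have := g0 _ T0T s1; move: h; set y := eta_integral _ _ _.
  set y0 := eta_integral _ _ _ => h y00.
  have -> : y = expR (r * t) * (expR (- (r * t)) * y).
    by rewrite mulrA -expRD subrr expR0 mul1r.
  apply: le_trans (ler_wpM2l (expR_ge0 _) h) _.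
  apply: ler_wpM2r => //.
  rewrite ler_expR; apply: le_trans (ler_norm _) _; rewrite normrM (ger0_norm t0).
  by rewrite ler_wpM2l.
have k1 := key 1 r1 (expr1n _ _) (h1 t tT).
have k2 := key (-1) r2 sqN1 (h2 t tT).
rewrite ler_pdivlMr//; apply: le_trans (lerD k1 k2).
rewrite (eta_integral1 _ (he0 1)) (eta_integral1 _ (he0 (-1))).
have -> : vintegral (B t) setT (e (-1) t) = -1 * vintegral (B t) setT (e 1 t).
  rewrite -vintegralZ//; congr vintegral; apply/funext => x.
  by rewrite /e scale1r.
lra.
Qed.

End Dissipation.

(** * Testing with the smooth solution *)

Section SmoothSolution.
Context {R : realType} {d : nat} {T : R} {b v : stfield R d}.
Context (T0 : 0 < T) (hbv : csf_smooth_solution T b v).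
Local Notation torus := (torus R d).

(** Differentiate [b . b = 1]. *)
Lemma unit_field_orth t j (x : torus) : t \in `[0, T] ->
  \sum_i b t x 0 i * pd j (component i (b t)) x = 0.
Proof.
move=> tT; have [hb _ ub _] := hbv.
pose f i : 'rV[R]_d -> R := component i (b t) \o tpi.
have df i : is_derive (repr x) (delta_mx 0 j) (f i) (pd j (component i (b t)) x).
  have [_ _ h _ _] := hb i; have /derivableP := h j t x tT; exact.
have dff i : is_derive (repr x) (delta_mx 0 j) (f i * f i)
    (f i (repr x) *: pd j (component i (b t)) x + f i (repr x) *: pd j (component i (b t)) x).
  by have ? := df i; exact: is_deriveM.
have := is_derive_sum dff.
have -> : \sum_(i < d) f i * f i = cst 1.
  by apply/funext => y; rewrite fct_sumE /= -(ub t (tpi y) tT).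
move=> [_]; rewrite derive_cst => /esym h.
set S := (X in X = 0); have e2 : 2 * S = 0.
  rewrite mulr_sumr -[RHS]h; apply: eq_bigr => i _; rewrite /f /= tpi_repr /component.
  by rewrite /GRing.scale/=; ring.
by apply/eqP; move/eqP: e2; rewrite mulf_eq0 pnatr_eq0.
Qed.

Lemma smooth_solution_L3 t (x : torus) : t \in `[0, T] -> L3 b v t x = 0.
Proof.
move=> tT; have [_ _ _ /(_ t x tT)[_ vE]] := hbv.
by rewrite /L3 -vE addNr.
Qed.

(** As [v = (b . nabla) b], this is the derivative of [b . b / 2] along [b]. *)
Lemma velocity_orth t (x : torus) : t \in `[0, T] -> dot (b t x) (v t x) = 0.
Proof.
move=> tT; have [_ _ _ /(_ t x tT)[_ ->]] := hbv.
rewrite /dot; under eq_bigr do rewrite mxE /advs mulr_sumr.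
rewrite exchange_big big1// => j _ /=.
under eq_bigr do rewrite mulrCA.
by rewrite -mulr_sumr unit_field_orth// mulr0.
Qed.

Lemma smooth_solution_L2 t (x : torus) : t \in `[0, T] -> L2 T b v t x = 0.
Proof.
move=> tT; have [_ _ _ /(_ t x tT)[bE _]] := hbv.
have -> : L2 T b v t x = (adv (b t x) (v t) x + dot (v t x) (v t x) *: b t x)
    - (dtimev T b t x + adv (v t x) (b t) x)
    - advs (b t x) (fun y => dot (b t y) (v t y)) x *: b t x.
  by rewrite /L2 opprD; apply/rowP => i; rewrite !mxE; ring.
rewrite bE subrr add0r (_ : (fun y => _) = fun=> 0); last first.
  by apply/funext => y; exact: velocity_orth.
by rewrite /advs big1 ?scale0r ?oppr0// => j _; rewrite pd_cst mulr0.
Qed.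

Context {K1 K2 : R -> R -> R} {cstar : stfield R d -> stfield R d -> R}
  {B : R -> vmeasure torus R d} {P : vmeasure (R * torus)%type R d}.
Context (hd : (0 < d)%N) (hD : dissipative_solution T K1 K2 cstar (B 0) B P)
  (hB0 : polar (B 0) (b 0)).

Let hb : C1fieldst T b. Proof. by case: hbv. Qed.
Let hv : C1fieldst T v. Proof. by case: hbv. Qed.
Let ub : unit_field T b. Proof. by case: hbv. Qed.
Let T0T : 0 \in `[0, T]. Proof. by rewrite in_itv/= lexx ltW. Qed.
Let bd t : t \in `[0, T] -> bdfield (b t). Proof. exact: C1fieldst_bdfield. Qed.

(** The defect vanishes initially, hence at all times, so that [b t] attains the
    total mass of [B t]. *)
Lemma polar_all_times t : t \in `[0, T] -> polar (B t) (b t).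
Proof.
move=> tT.
have [r /(_ t tT)] := defect_decay T0 hD hb hv ub smooth_solution_L2 smooth_solution_L3.
have -> : eta_integral (B 0) (b 0) (cst 1) = 0.
  rewrite eta_integral1; last exact: bd.
  rewrite (polar_vintegral (bd T0T) (bd T0T) hB0).
  rewrite -[fine _]mul1r -Rintegral_cst//; apply/eqP; rewrite subr_eq0; apply/eqP.
  by apply: eq_Rintegral => x _; rewrite ub.
rewrite pmulr_rle0 ?expR_gt0// eta_integral1 ?subr_le0; last exact: bd.
by apply: polar_of_norming; [exact: bd|move=> x; exact: ub].
Qed.

Lemma cintegral_weak_continuous i (phi : torus -> R) : continuous phi ->
  {within `[0, T], continuous (fun t => cintegral (B t i) setT phi)}.
Proof.
move=> cphi.
have -> : (fun t => cintegral (B t i) setT phi) =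
    (fun t => vintegral (B t) setT (fun x => phi x *: delta_mx 0 i)).
  by apply/funext => t; rewrite vintegral_delta.
apply: (ds_weak_continuous hD) => x; have h := cphi x; exact: (cvgZr_tmp h).
Qed.

(** The total variation is in general only lower semicontinuous for weak-*
    convergence; here [|B(t)| = b(t) . B(t)] turns the integral into integrals
    against [B(t)]. *)
Lemma totvar_time_continuous (f : R -> torus -> R) : cont_st T f ->
  {within `[0, T], continuous (fun t => \int[totvar (B t)]_x f t x)}.
Proof.
move=> cf; have [M BM] := mass_bounded T0 hD hd.
have h i : {within `[0, T], continuous (fun t => cintegral (B t i) setT (fun x => f t x * b t x 0 i))}.
  apply: (@cintegral_time_continuous _ _ _ T B i (fun t x => f t x * b t x 0 i) M) => //.
    exact: cintegral_weak_continuous.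
  by apply: cont_stM => //; exact: C1fieldst_cont.
have : {within `[0, T], continuous (fun t => \sum_i cintegral (B t i) setT (fun x => f t x * b t x 0 i))}.
  by apply: (@continuous_big _ _ +%R 0 xpredT (@add_continuous R)) => i _; exact: h.
apply: subspace_eq_continuous => t /set_mem tT.
have bf : bdmeas setT (f t).
  by apply: torus_continuous_bdmeas; exact: (cont_st_slice cf tT).
have hw : bdfield (fun x => f t x *: b t x).
  by move=> i; under eq_fun do rewrite mxE; apply: bdmeasM => //; exact: bd.
have := polar_vintegral (bd tT) hw (polar_all_times tT).
rewrite /vintegral /=; under eq_bigr do under eq_fun do rewrite mxE.
move=> E; rewrite /from_subspace/= E; apply: eq_Rintegral => x _.
by rewrite -[_ *: _]addr0 -(scale0r 0) dot_lin ub// mul0r addr0 mulr1.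
Qed.

Lemma lebesgue_itv_lty : (lebesgue_measure `[0%R, T]%classic < +oo)%E.
Proof. by rewrite lebesgue_measure_itv/=; case: ifP => _; rewrite ?ltry// -EFinB ltry. Qed.

Lemma time_bdmeas (g : R -> R) : {within `[0, T], continuous g} -> bdmeas `[0%R, T]%classic g.
Proof.
move=> cg; split.
  by apply: subspace_continuous_measurable_fun => //; exact: measurable_itv.
have /compact_bounded[M [_ gM]] := continuous_compact cg (@segment_compact R 0 T).
by exists (M + 1) => t tT; apply: (gM (M + 1)); [rewrite ltrDl|exists t].
Qed.

Lemma eta_polar t (k : torus -> R) : t \in `[0, T] -> bdmeas setT k ->
  eta_integral (B t) (b t) k = 0.
Proof.
move=> tT hk; rewrite /eta_integral.
have hw : bdfield (fun x => k x *: b t x).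
  by move=> j; under eq_fun do rewrite mxE; apply: bdmeasM => //; exact: bd.
rewrite (polar_vintegral (bd tT) hw (polar_all_times tT)).
apply/eqP; rewrite subr_eq0; apply/eqP/eq_Rintegral => x _.
by rewrite -[_ *: _]addr0 -(scale0r 0) dot_lin ub// mul0r addr0 mulr1.
Qed.

Lemma vintegral_polar t (k : torus -> R) : t \in `[0, T] -> bdmeas setT k ->
  vintegral (B t) setT (fun x => k x *: b t x) = \int[totvar (B t)]_x k x.
Proof.
by move=> tT hk; apply/esym/eqP; rewrite -subr_eq0; apply/eqP; exact: eta_polar.
Qed.

Lemma bdmeas_prod (chi : R -> R) (psi : torus -> R) :
  continuous chi -> continuous psi -> (forall t, 0 <= chi t <= 1) ->
  (forall x, 0 <= psi x <= 1) ->
  bdmeas setT (fun z : R * torus => chi z.1 * psi z.2).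
Proof.
move=> cchi cpsi chi01 psi01; split.
  apply: measurable_funM.
    by apply: (measurableT_comp (f := chi)) => //; exact: continuous_measurable_fun.
  by apply: (measurableT_comp (f := psi)) => //; exact: torus_continuous_measurable.
exists 1 => z _; have /andP[m0 m1] := mul_itv01 (chi01 z.1) (psi01 z.2).
by rewrite ger0_norm.
Qed.

(** The trial momentum is [e] times the product of [chi], [psi] and an exponential
    weight. As the defect vanishes, the dissipation inequality bounds [e] times the
    difference of the two sides by an error of order [e^2], for both signs of
    [e]. *)
Lemma momentum_test i (chi chi' : R -> R) (psi : torus -> R) :
  C1fun chi chi' -> Ck 1 psi ->
  (forall t, 0 <= chi t <= 1) -> (forall x, 0 <= psi x <= 1) ->
  cintegral (P i) (cylinder T) (fun z => chi z.1 * psi z.2) =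
  \int[lebesgue_measure]_(s in `[0, T]) \int[totvar (B s)]_x (chi s * psi x * v s x 0 i).
Proof.
move=> hchi hpsi chi01 psi01.
have TT : T \in `[0, T] by rewrite in_itv/= lexx ltW.
have cchi := C1fun_continuous hchi.
have cpsi : continuous psi by case: hpsi.
pose c := cstar b v.
(* Nonnegativity of r is what keeps the weight E below 1 on [0, T]. *)
pose r := Num.max 0 (c + 1 ^+ 2 / 2 + 1 * supnorm T v).
have r0 : 0 <= r by rewrite le_max lexx.
have rle : c + 1 ^+ 2 / 2 + 1 * supnorm T v <= r by rewrite le_max lexx orbT.
(* E cancels the weight exp(- r s) of the inequality, up to a constant factor. *)
pose E (s : R) : R := expR (- (r * T) + r * s).
have hE : C1fun E (fun s => E s * r) := C1fun_comp C1fun_expR (C1fun_affine (- (r * T)) r).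
have cE := C1fun_continuous hE.
have E01 s : s \in `[0, T] -> 0 <= E s <= 1.
  rewrite in_itv/= => /andP[_ sT]; rewrite expR_ge0 /= -expR0 ler_expR.
  by rewrite addrC subr_le0 ler_wpM2l.
pose f s x := chi s * psi x.
set X := cintegral _ _ _; set Y := Rintegral _ _ _.
pose y s := \int[totvar (B s)]_x (f s x * v s x 0 i).
pose z s := \int[totvar (B s)]_x (E s * (f s x * f s x)).
pose Z := \int[lebesgue_measure]_(s in `[0, T]) z s.
have cf : cont_st T f by exact: cont_st_prod.
have cEf2 : cont_st T (fun s x => E s * (f s x * f s x)).
  apply: cont_stM; last exact: cont_stM.
  have := cont_st_prod (T := T) cE (@cst_continuous torus R 1).
  by under eq_fun do rewrite mulr1.
have cfv : cont_st T (fun s x => f s x * v s x 0 i).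
  by apply: cont_stM => //; exact: C1fieldst_cont.
have cy : {within `[0, T], continuous y} by exact: totvar_time_continuous.
have cz : {within `[0, T], continuous z} by exact: totvar_time_continuous.
have key (e : R) : `|e| <= 1 -> e * X - e * Y - e ^+ 2 / 2 * Z <= 0.
  move=> e1.
  pose g (s : R) : R := e * (E s * chi s).
  have hg := C1funM (C1fun_cst e) (C1funM hE hchi).
  pose A : stfield R d := fun s x => (g s * psi x) *: delta_mx 0 i.
  have hA : C1fieldst T A := C1fieldst_prod T0 i hg hpsi.
  have An s x : s \in `[0, T] -> enorm (A s x) <= 1.
    move=> sT; apply: le_trans (enorm_le_sum _) _.
    rewrite (bigD1 i)//= big1 ?addr0 => [|j ji]; last first.
      by rewrite !mxE (negbTE ji) andbF mulr0 normr0.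
    rewrite !mxE !eqxx mulr1 /g -!mulrA normrM mulr_ile1//.
    have /andP[m0 m1] := mul_itv01 (E01 _ sT) (mul_itv01 (chi01 s) (psi01 x)).
    by rewrite ger0_norm.
  have sA : supnorm T A <= 1.
    apply: ge_sup; first by exists (enorm (A 0 point)); exists (0, point).
    by move=> _ [[s x] [/= sT _] <-]; exact: An.
  have := ds_dissipation hD (@ltr01 R) TT hb hv hA ub sA rle.
  rewrite /= !eta_polar//; try exact: bdmeas_cst.
  rewrite mulr0 add0r.
  have -> : vintegral P (cylinder T)
      (fun z => expR (- (r * z.1)) *: (A z.1 z.2 - L3 b v z.1 z.2)) =
      e * expR (- (r * T)) * X.
    rewrite /X -cintegralZ; last 2 first.
    - exact: measurable_cylinder.
    - by apply: (@bdmeas_sub _ _ _ _ setT) => //; exact: bdmeas_prod.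
    rewrite -vintegral_delta; last exact: measurable_cylinder.
    apply: eq_vintegral => -[s x] /set_mem[/= sT _].
    rewrite smooth_solution_L3// subr0 /A scalerA; congr (_ *: _).
    by rewrite /g /E expRD expRN; field; rewrite gt_eqF ?expR_gt0.
  have -> : \int[lebesgue_measure]_(s in `[0, T]) (expR (- (r * s)) *
      (eta_integral (B s) (b s)
         (fun x => r - cstar b v - dot (A s x) (A s x + 2 *: v s x) / 2) -
       vintegral (B s) setT (fun x => L2 T b v s x +
         (dot (A s x) (A s x + 2 *: v s x) / 2) *: b s x))) =
    \int[lebesgue_measure]_(s in `[0, T])
      (- expR (- (r * T)) * (e * y s + e ^+ 2 / 2 * z s)).
    apply: eq_Rintegral => s /set_mem sT.
    pose h x := (E s * e) * (f s x * v s x 0 i)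
      + (E s * (e ^+ 2 / 2)) * (E s * (f s x * f s x)).
    have hE' x : dot (A s x) (A s x + 2 *: v s x) / 2 = h x.
      rewrite dot_delta.
      rewrite /A !mxE !eqxx /h /g /f /= mulr1.
      by field.
    have bf1 : bdmeas setT (fun x => f s x * v s x 0 i).
      by apply: torus_continuous_bdmeas; exact: (cont_st_slice cfv sT).
    have bf2 : bdmeas setT (fun x => E s * (f s x * f s x)).
      by apply: torus_continuous_bdmeas; exact: (cont_st_slice cEf2 sT).
    have bh : bdmeas setT h by apply: bdmeasD; exact: bdmeasZ.
    have iB k : bdmeas setT k -> (totvar (B s)).-integrable setT (EFin \o k).
      by move=> hk; apply: bdmeas_integrable => //; exact: totvar_lty.
    rewrite eta_polar//; last first.
      by under eq_fun do rewrite hE'; apply: bdmeasB => //; exact: bdmeas_cst.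
    have -> : (fun x => L2 T b v s x + (dot (A s x) (A s x + 2 *: v s x) / 2) *: b s x) =
        (fun x => h x *: b s x).
      by apply/funext => x; rewrite smooth_solution_L2// add0r hE'.
    rewrite vintegral_polar// sub0r /h RintegralD//; try by apply: iB; exact: bdmeasZ.
    have bff : bdmeas setT (fun x => f s x * f s x).
      by apply: torus_continuous_bdmeas; exact: (cont_st_slice (cont_stM cf cf) sT).
    have zE : z s = E s * \int[totvar (B s)]_x (f s x * f s x).
      by rewrite /z RintegralZl//; exact: iB.
    rewrite !RintegralZl//; try exact: iB.
    have -> : expR (- (r * T)) = expR (- (r * s)) * E s.
      by rewrite /E -expRD; congr expR; ring.
    by rewrite zE /y; ring.
  have iT k : bdmeas `[0%R, T]%classic k ->
      lebesgue_measure.-integrable `[0%R, T]%classic (EFin \o k).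
    by move=> hk; apply: bdmeas_integrable => //; exact: lebesgue_itv_lty.
  have by_ := time_bdmeas cy; have bz_ := time_bdmeas cz.
  rewrite RintegralZl//; last by apply: iT; apply: bdmeasD; exact: bdmeasZ.
  rewrite RintegralD//; try by apply: iT; exact: bdmeasZ.
  rewrite !RintegralZl//; try exact: iT.
  rewrite -/Z (_ : \int[_]_(_ in _) y _ = Y)//.
  have -> : e * expR (- (r * T)) * X + - expR (- (r * T)) * (e * Y + e ^+ 2 / 2 * Z) =
    expR (- (r * T)) * (e * X - e * Y - e ^+ 2 / 2 * Z) by ring.
  by rewrite pmulr_rle0// expR_gt0.
apply/eqP; rewrite -subr_eq0; apply: contraT => XY.
have D0 : 0 < `|X - Y| by rewrite normr_gt0.
have Z1 : 0 < `|Z| + 1 by rewrite ltr_pwDr.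
(* The quadratic error is then at most |X - Y| / 2. *)
pose e := Num.min 1 (`|X - Y| / (`|Z| + 1)).
have e0 : 0 < e by rewrite lt_min ltr01 divr_gt0.
have e1 : `|e| <= 1 by rewrite gtr0_norm// ge_min lexx.
have eZ : e * (`|Z| + 1) <= `|X - Y|.
  by rewrite -ler_pdivlMr// ge_min lexx orbT.
have k1 := key e e1.
have k2 : - e * X - - e * Y - (- e) ^+ 2 / 2 * Z <= 0 by apply: key; rewrite normrN.
have h : e * `|X - Y| <= e * (e / 2 * `|Z|).
  have ZZ : e ^+ 2 / 2 * Z <= e ^+ 2 / 2 * `|Z|.
    by rewrite ler_wpM2l ?ler_norm// divr_ge0 ?sqr_ge0.
  have [XYp|XYn] := ger0P (X - Y); move: k1 k2; rewrite sqrrN; nra.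
by move: h; rewrite ler_pM2l//; nra.
Qed.

End SmoothSolution.

(** * Identification of the momentum *)

Section Conclusion.
Context {R : realType} {d : nat} {T : R} {b v : stfield R d}.
Context (T0 : 0 < T) (hbv : csf_smooth_solution T b v).
Local Notation torus := (torus R d).
Context {K1 K2 : R -> R -> R} {cstar : stfield R d -> stfield R d -> R}
  {B : R -> vmeasure torus R d} {P : vmeasure (R * torus)%type R d}.
Context (hd : (0 < d)%N) (hD : dissipative_solution T K1 K2 cstar (B 0) B P)
  (hB0 : polar (B 0) (b 0)).

Let I := `[0%R, T]%classic.
Let mI : measurable I. Proof. exact: measurable_itv. Qed.
Let bv t i : t \in `[0, T] -> bdmeas setT (fun x => v t x 0 i).
Proof. by move=> tT; have [_ hv _ _] := hbv; exact: C1fieldst_bdfield hv tT i. Qed.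
Let intB t k : bdmeas setT k -> (totvar (B t)).-integrable setT (EFin \o k).
Proof. by move=> hk; apply: bdmeas_integrable => //; exact: totvar_lty. Qed.

Definition fiber_pairing i (f : R * torus -> R) (t : R) : R :=
  \int[totvar (B t)]_x (f (t, x) * v t x 0 i).

(** Measurability in time belongs to the property that is extended by the
    monotone class argument: at first it is only known for continuous [f]. *)
Definition momentum_eq i (f : R * torus -> R) : Prop :=
  measurable_fun I (fiber_pairing i f) /\
  cintegral (P i) (cylinder T) f = \int[lebesgue_measure]_(t in I) fiber_pairing i f t.

Lemma bdmeas_slice (f : R * torus -> R) t : bdmeas setT f -> bdmeas setT (fun x => f (t, x)).
Proof.
move=> [mf [M fM]]; split; last by exists M => x _; exact: fM.
by apply: (measurableT_comp (f := f)).
Qed.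

Lemma fiber_pairing_bounded i : exists N : R, forall f M t, (forall z, `|f z| <= M) ->
  bdmeas setT f -> t \in `[0, T] -> `|fiber_pairing i f t| <= M * N.
Proof.
have [M1 BM] := mass_bounded T0 hD hd.
have [_ hv _ _] := hbv.
have [V vV] := cont_st_bounded (C1fieldst_cont (i := i) hv).
exists (V * M1) => f M t fM hf tT; rewrite /fiber_pairing.
have hfv : bdmeas setT (fun x => f (t, x) * v t x 0 i).
  by apply: bdmeasM; [exact: bdmeas_slice|exact: bv].
have M0 : 0 <= M by apply: le_trans (fM (t, point)).
have V0 : 0 <= V by apply: le_trans (vV t point tT).
apply: le_trans (le_normr_Rintegral measurableT (intB t hfv)) _.
apply: (@le_trans _ _ (\int[totvar (B t)]_(x in setT) (M * V))).
  apply: le_Rintegral => //.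
  - by have := integrable_abse (intB t hfv).
  - by apply: intB; exact: bdmeas_cst.
  - by move=> x _; rewrite normrM ler_pM// vV.
by rewrite Rintegral_cst// -mulrA ler_wpM2l// ler_wpM2l// BM.
Qed.

Lemma fiber_pairing_bdmeas i f : bdmeas setT f -> momentum_eq i f ->
  bdmeas I (fiber_pairing i f).
Proof.
move=> hf [mf _]; split => //; have [N hN] := fiber_pairing_bounded i.
have [_ [M fM]] := hf; exists (M * N) => t tT; apply: hN => // z; exact: fM.
Qed.

Lemma fiber_pairing_integrable i f : bdmeas setT f -> momentum_eq i f ->
  lebesgue_measure.-integrable I (EFin \o fiber_pairing i f).
Proof.
move=> hf qf; apply: bdmeas_integrable => //; first exact: lebesgue_itv_lty.
exact: fiber_pairing_bdmeas.
Qed.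

Lemma bdmeas_cylinder (f : R * torus -> R) : bdmeas setT f -> bdmeas (cylinder T) f.
Proof. by apply: bdmeas_sub. Qed.

Lemma momentum_eqD i f g : bdmeas setT f -> bdmeas setT g ->
  momentum_eq i f -> momentum_eq i g -> momentum_eq i (fun z => f z + g z).
Proof.
move=> hf hg qf qg; have [mf ef] := qf; have [mg eg] := qg.
have E : {in I, forall t, fiber_pairing i f t + fiber_pairing i g t =
    fiber_pairing i (fun z => f z + g z) t}.
  move=> t /set_mem tT; rewrite /fiber_pairing -RintegralD//; last 2 first.
  - by apply: intB; apply: bdmeasM; [exact: bdmeas_slice|exact: bv].
  - by apply: intB; apply: bdmeasM; [exact: bdmeas_slice|exact: bv].
  by apply: eq_Rintegral => x _; rewrite mulrDl.
split; first by apply: (eq_measurable_fun _ E); exact: measurable_realfun.measurable_funD.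
rewrite cintegralD; [|exact: measurable_cylinder|exact: bdmeas_cylinder|exact: bdmeas_cylinder].
rewrite ef eg -(RintegralD _ (fiber_pairing_integrable hf qf) (fiber_pairing_integrable hg qg))//.
exact: eq_Rintegral.
Qed.

Lemma momentum_eqZ i c f : bdmeas setT f -> momentum_eq i f ->
  momentum_eq i (fun z => c * f z).
Proof.
move=> hf qf; have [mf ef] := qf.
have E : {in I, forall t, c * fiber_pairing i f t = fiber_pairing i (fun z => c * f z) t}.
  move=> t /set_mem tT; rewrite /fiber_pairing -RintegralZl//; last first.
    by apply: intB; apply: bdmeasM; [exact: bdmeas_slice|exact: bv].
  by apply: eq_Rintegral => x _; rewrite mulrA.
split; first by apply: (eq_measurable_fun _ E); apply: measurable_funM.
rewrite cintegralZ; [|exact: measurable_cylinder|exact: bdmeas_cylinder].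
rewrite ef -(RintegralZl _ _ (fiber_pairing_integrable hf qf))//.
exact: eq_Rintegral.
Qed.

Lemma momentum_eq_lim i (F : nat -> R * torus -> R) f (M : R) :
  (forall n, bdmeas setT (F n)) -> (forall n, momentum_eq i (F n)) ->
  (forall n z, `|F n z| <= M) -> (forall z, F ^~ z @ \oo --> f z) -> momentum_eq i f.
Proof.
move=> hF qF FM Ff; have [N hN] := fiber_pairing_bounded i.
have c t : I t -> fiber_pairing i (F n) t @[n --> \oo] --> fiber_pairing i f t.
  move=> tT; have [_ [V vV]] := bv i tT.
  apply: (@bounded_cvg_Rintegral _ _ _ _ _ _ _ (M * V)) => //.
  - exact: totvar_lty.
  - move=> n; apply: measurable_funM; first by have [] := bdmeas_slice t (hF n).
    by have [] := bv i tT.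
  - by move=> n x _; rewrite normrM ler_pM// vV.
  - by move=> x _; apply: cvgMr_tmp; exact: Ff.
split.
  by apply: (measurable_fun_cvg (h := fun n => fiber_pairing i (F n))) => // n; case: (qF n).
have c1 : cintegral (P i) (cylinder T) (F n) @[n --> \oo] --> cintegral (P i) (cylinder T) f.
  apply: (@cintegral_cvg _ _ _ _ _ _ _ M) => //; first exact: measurable_cylinder.
  by move=> n; have [] := bdmeas_cylinder (hF n).
move: c1; rewrite (_ : (fun n => cintegral (P i) (cylinder T) (F n)) =
    (fun n => \int[lebesgue_measure]_(t in I) fiber_pairing i (F n) t)); last first.
  by apply/funext => n; case: (qF n).
move=> c1; apply: (cvg_unique _ c1) => //; rewrite /=.
apply: (@bounded_cvg_Rintegral _ _ _ _ _ _ _ (M * N)) => //.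
- exact: lebesgue_itv_lty.
- by move=> n; case: (qF n).
- by move=> n t tT; apply: hN.
Qed.

Lemma momentum_eq_prod i (chi chi' : R -> R) (psi : torus -> R) :
  C1fun chi chi' -> Ck 1 psi ->
  (forall t, 0 <= chi t <= 1) -> (forall x, 0 <= psi x <= 1) ->
  momentum_eq i (fun z => chi z.1 * psi z.2).
Proof.
move=> hchi hpsi chi01 psi01; split.
  apply: (time_bdmeas _).1; apply: (totvar_time_continuous T0 hbv hd hD hB0
    (f := fun t x => chi t * psi x * v t x 0 i)).
  apply: cont_stM; last by have [_ hv _ _] := hbv; exact: C1fieldst_cont.
  by apply: cont_st_prod; [exact: C1fun_continuous hchi|case: hpsi].
exact: (momentum_test T0 hbv hd hD hB0 i hchi hpsi chi01 psi01).
Qed.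

Lemma momentum_eq_all i f : bdmeas setT f -> momentum_eq i f.
Proof.
apply: (monotone_class (G := @approx_rect R d)).
- exact: measurable_approx_rect.
- exact: approx_rectI.
- by exists setT; [exact: approx_timeT|exists setT; [exact: approx_torusT|rewrite setXTT]].
- move=> _ [A [chi [chi' [hchi chi01 chiA]]] [U [psi [hpsi psi01 psiU]] <-]].
  apply: (@momentum_eq_lim i (fun n z => chi n z.1 * psi n z.2) _ 1).
  + move=> n; apply: bdmeas_prod => //; first exact: C1fun_continuous (hchi n).
    by case: (hpsi n).
  + by move=> n; exact: momentum_eq_prod (hchi n) (hpsi n) _ _.
  + move=> n z; have /andP[m0 m1] := mul_itv01 (chi01 n z.1) (psi01 n z.2).
    by rewrite ger0_norm.
  + move=> z; have -> : \1_(A `*` U) z = \1_A z.1 * \1_U z.2 :> R.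
      by rewrite !indicE in_setX; case: (_ \in A); rewrite ?mul1r ?mul0r.
    by apply: cvgM; [exact: chiA|exact: psiU].
- exact: momentum_eqD.
- by move=> c g; exact: momentum_eqZ.
- exact: momentum_eq_lim.
Qed.

Lemma momentum_polar i E : measurable E -> P i E = st_fmeasure T B v i E.
Proof.
move=> mE; have [mF eF] := momentum_eq_all i (bdmeas_indic setT mE).
have PE : fine (P i E) = cintegral (P i) (cylinder T) \1_E.
  rewrite cintegral_indic//; last exact: measurable_cylinder.
  have mC := @measurable_cylinder R d T.
  rewrite -[in LHS](setIT E) -(setUv (cylinder T)) setIUr chargeU//; first last.
  - by rewrite setIACA setICr setI0.
  - by apply: measurableI => //; exact: measurableC.
  - exact: measurableI.
  rewrite (ds_carried hD i (E := E `&` ~` cylinder T)) ?adde0//.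
    by apply: measurableI => //; exact: measurableC.
  by rewrite -setIA setICl setI0.
have fE t : I t -> fmeasure (totvar (B t)) (v t) i (xsection E t) = (fiber_pairing i \1_E t)%:E.
  move=> tT.
  have mx : measurable (xsection E t) by exact: measurable_xsection.
  have iv : (totvar (B t)).-integrable (xsection E t) (EFin \o (fun x => v t x 0 i)).
    apply: bdmeas_integrable => //; first exact: totvar_lty.
    exact: bdmeas_sub (bv i tT).
  rewrite -[LHS]fineK; last exact: integrable_fin_num.
  congr (_%:E); rewrite -/(Rintegral _ _ _) Rintegral_mkcond; apply: eq_Rintegral => x _.
  rewrite patchE indicE mem_xsection; case: ifP => h; rewrite ?h ?mul1r ?mul0r//.
rewrite -[LHS]fineK ?fin_num_measure// PE eF /st_fmeasure fineK; last first.
  apply: integrable_fin_num => //.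
  exact: (@fiber_pairing_integrable i \1_E (bdmeas_indic setT mE) (conj mF eF)).
by apply: eq_integral => t /set_mem tT; rewrite fE.
Qed.

Lemma field_polar i E : measurable E -> st_measure T B i E = st_fmeasure T B b i E.
Proof.
move=> mE; apply: eq_integral => t /set_mem tT.
apply: (polar_all_times T0 hbv hD hB0) => //; exact: measurable_xsection.
Qed.

End Conclusion.

Theorem theorem0p3 (R : realType) (d : nat) (T : R)
    (K1 K2 : R -> R -> R) (cstar : stfield R d -> stfield R d -> R)
    (b v : stfield R d)
    (B : R -> vmeasure (torus R d) R d)
    (P : vmeasure (R * torus R d)%type R d) :
  0 < T -> (0 < d)%N ->
  cstar_spec T cstar ->
  csf_smooth_solution T b v ->
  dissipative_solution T K1 K2 cstar (B 0) B P ->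
  (forall i (E : set (torus R d)), measurable E ->
     B 0 i E = fmeasure (totvar (B 0)) (b 0) i E) ->
  forall i (E : set (R * torus R d)), measurable E ->
    st_measure T B i E = st_fmeasure T B b i E /\
    P i E = st_fmeasure T B v i E.
Proof.
move=> T0 d0 _ hbv hD hB0 i E mE; split.
  exact: (field_polar T0 hbv hD hB0).
exact: (momentum_polar T0 hbv d0 hD hB0).
Qed.
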